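(* Let $\mathfrak{g}=\mathfrak{p}_n^A\frac{a_1|\cdots|a_m}{b_1|\cdots|b_t}$ be a type-$A$ seaweed. Then $\mathfrak{g}$ is contact if and only if $\operatorname{ind}\mathfrak{g}=1$.
   Context: All Lie algebras are finite-dimensional over $\mathbb{C}$. Type-$A$ seaweeds: let $(a_1,\dots,a_m)$ and $(b_1,\dots,b_t)$ be two ordered compositions of $n$ (into positive parts). Each composition divides $\{1,\dots,n\}$ into consecutive blocks of the given sizes. Let $D_{(a)}$ (resp. $D_{(b)}$) be the block-diagonal $n\times n$ complex matrices with diagonal blocks of sizes $a_1,\dots,a_m$ (resp. $b_1,\dots,b_t$). The type-$A$ seaweed $\mathfrak{p}_n^A\frac{a_1|\cdots|a_m}{b_1|\cdots|b_t}$ is the subalgebra of $\mathfrak{sl}(n,\mathbb{C})$ consisting of the trace-zero matrices in the span of the lower-triangular matrices in $D_{(a)}$ and the upper-triangular matrices in $D_{(b)}$. Equivalently, it is the set of trace-zero matrices whose $(i,j)$ entry is zero unless $i\ge j$ and $i,j$ lie in the same block of $(a)$, or $i\le j$ and $i,j$ lie in the same block of $(b)$. Index: for a Lie algebra $\mathfrak{f}$ and $\varphi\in\mathfrak{f}^*$ let $B_\varphi(x,y)=\varphi([x,y])$ be the Kirillov form, with $\ker(B_\varphi)=\{x\in\mathfrak{f} : B_\varphi(x,y)=0\ \forall y\in\mathfrak{f}\}$. The index is $\operatorname{ind}\mathfrak{f}=\min_{\varphi\in\mathfrak{f}^*}\dim\ker(B_\varphi)$. Contact: a Lie algebra $\mathfrak{f}$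 is contact if $\dim\mathfrak{f}=2k+1$ is odd and there exists $\varphi\in\mathfrak{f}^*$ with $\varphi\wedge(d\varphi)^k\neq 0$ in $\Lambda^{2k+1}\mathfrak{f}^*$, where $d\varphi(x,y)=-\varphi([x,y])$ (the sign convention is immaterial). *)

(* Defs.v *)
From HB Require Import structures.
From mathcomp Require Import all_boot all_order all_algebra all_fingroup.
From mathcomp Require Import complex boolp reals ring.

Set Implicit Arguments.
Unset Strict Implicit.
Unset Printing Implicit Defensive.

Import Order.TTheory GRing.Theory Num.Theory.
Local Open Scope ring_scope.

HB.mixin Record Vector_isLie (K : fieldType) L of Vector K L := {
  lie : L -> L -> L;
  lie_linearr : forall x, linear (lie x);
  lie_linearl : forall y, linear (lie^~ y);
  liexx : forall x, lie x x = 0;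
  lie_jacobi : forall x y z,
    lie x (lie y z) + lie y (lie z x) + lie z (lie x y) = 0
}.

#[short(type="lieAlgType")]
HB.structure Definition LieAlgebra (K : fieldType) :=
  { L of Vector K L & Vector_isLie K L }.

Section Index.
Variables (K : fieldType) (L : lieAlgType K).
Implicit Types (phi : 'Hom(L, K^o)).

Definition kirillov phi (x y : L) : K := phi (lie x y).

Lemma kirillov_linearr phi x : linear (kirillov phi x : L -> K^o).
Proof. by move=> c y z; rewrite /kirillov lie_linearr linearP. Qed.

Definition kirillov_flat phi (x : L) : 'Hom(L, K^o) :=
  linfun (kirillov phi x : L -> K^o).

Lemma kirillov_flatE phi x y : kirillov_flat phi x y = kirillov phi x y.
Proof.
pose m := GRing.isLinear.Build _ _ _ _ (kirillov phi x : L -> K^o)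
  (kirillov_linearr phi x).
pose f : {linear L -> K^o} := HB.pack (kirillov phi x : L -> K^o) m.
exact: (lfunE f).
Qed.

Lemma kirillov_flat_linear phi : linear (kirillov_flat phi).
Proof.
move=> c x y; apply/lfunP=> z; rewrite add_lfunE scale_lfunE !kirillov_flatE.
by rewrite /kirillov lie_linearl linearP.
Qed.

Definition kirillov_ker phi : {vspace L} := lker (linfun (kirillov_flat phi)).

Lemma memv_kirillov_ker phi x :
  x \in kirillov_ker phi <-> forall y, kirillov phi x y = 0.
Proof.
pose m := GRing.isLinear.Build _ _ _ _ (kirillov_flat phi)
  (kirillov_flat_linear phi).
pose f : {linear L -> 'Hom(L, K^o)} := HB.pack (kirillov_flat phi) m.
have fE : linfun (kirillov_flat phi) x = kirillov_flat phi x by exact: (lfunE f).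
rewrite memv_ker fE; split=> [/eqP x0 y | x0].
  by rewrite -kirillov_flatE x0 zero_lfunE.
by apply/eqP/lfunP => y; rewrite kirillov_flatE zero_lfunE x0.
Qed.

Definition kirillov_ker_dim : pred nat :=
  fun k => `[< exists phi, \dim (kirillov_ker phi) = k >].

Lemma kirillov_ker_dim_ex : exists k, kirillov_ker_dim k.
Proof. by exists (\dim (kirillov_ker 0)); apply/asboolP; exists 0. Qed.

Definition lie_index : nat := ex_minn kirillov_ker_dim_ex.

End Index.

Section Contact.
Variables (K : numFieldType) (L : lieAlgType K).

(* An element of Lambda^p L^* is represented by its values on p-tuples of     *)
(* vectors. The type does not carry multilinearity and alternation; the forms *)
(* considered below, built from linear forms and brackets, have both.         *)
Definition cochain (p : nat) : Type := ('I_p -> L) -> K.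

Definition one_form (phi : 'Hom(L, K^o)) : cochain 1 := fun v => phi (v ord0).

Definition d_one_form (phi : 'Hom(L, K^o)) : cochain 2 :=
  fun v => - phi (lie (v ord0) (v ord_max)).

Definition wedge p q (f : cochain p) (g : cochain q) : cochain (p + q) := fun v =>
  (p`! * q`!)%:R^-1 * \sum_(s : 'S_(p + q))
    (-1) ^+ s * f (fun i => v (s (lshift q i))) * g (fun j => v (s (rshift p j))).

(* The recursive case typechecks because k.+1.*2 is convertible to            *)
(* 2 + k.*2.                                                                  *)
Fixpoint wedge_pow (w : cochain 2) (k : nat) : cochain k.*2 :=
  match k with
  | 0 => fun=> 1
  | k'.+1 => wedge w (@wedge_pow w k')
  end.
Arguments wedge_pow : clear implicits.

Definition contact : Prop :=
  exists k : nat, \dim {:L} = k.*2.+1 /\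
    exists phi : 'Hom(L, K^o),
      wedge (one_form phi) (wedge_pow (d_one_form phi) k) <> (fun=> 0).

End Contact.

Definition is_composition (n : nat) (a : seq nat) : bool :=
  (sumn a == n) && all (leq 1) a.

(* Positions are counted from 0, so rows and columns range over 0, ..., n-1.  *)
Definition same_block (a : seq nat) (i j : nat) : bool :=
  reshape_index a i == reshape_index a j.

Lemma reshape_index_homo a : {homo reshape_index a : i j / (i <= j)%N}.
Proof.
rewrite /reshape_index; elim: a => //= m a IHa i j le_ij.
rewrite !subn_eq0; case: (ltnP i m) => // le_mi.
have le_mj := leq_trans le_mi le_ij; rewrite (leq_gtF le_mj) ltnS !subSn //.
by rewrite IHa ?leq_sub2r.
Qed.

Lemma same_block_sym a : symmetric (same_block a).
Proof. by move=> i j; rewrite /same_block eq_sym. Qed.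

Lemma same_block_trans a : transitive (same_block a).
Proof. by move=> j i k; rewrite /same_block => /eqP->. Qed.

Lemma same_block_convex a i j k :
  (i <= j <= k)%N -> same_block a i k -> same_block a i j && same_block a j k.
Proof.
case/andP=> le_ij le_jk /eqP eq_ik; rewrite /same_block -eq_ik eq_sym andbb.
by rewrite eqn_leq {1}eq_ik !reshape_index_homo.
Qed.

Section Seaweed.
Variables (K : fieldType) (n : nat).
Implicit Types (a b : seq nat) (A B : 'M[K]_n).

Definition unit_span (P : rel 'I_n) : {vspace 'M[K]_n} :=
  (\sum_(p : 'I_n * 'I_n | P p.1 p.2) <[delta_mx p.1 p.2]>)%VS.

Lemma memv_unit_span P A :
  A \in unit_span P <-> forall i j, ~~ P i j -> A i j = 0.
Proof.
split=> [/memv_sumP[F memF ->] i j nPij | A0].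
  rewrite summxE big1 // => -[i' j'] Pij; have /vlineP[c ->] := memF _ Pij.
  rewrite !mxE /=; case: eqP => [ii|]; last by rewrite mulr0.
  case: eqP => [jj|]; last by rewrite mulr0.
  by move: nPij; rewrite ii jj Pij.
rewrite (matrix_sum_delta A) pair_bigA /= (bigID (fun p => P p.1 p.2)) /=.
rewrite [X in _ + X]big1 ?addr0 => [|p nP]; last by rewrite A0 ?scale0r.
by apply: memv_sumr => p _; rewrite memvZ ?memv_line.
Qed.

Definition lower_block a : {vspace 'M[K]_n} :=
  unit_span (fun i j => (j <= i)%N && same_block a i j).

Definition upper_block b : {vspace 'M[K]_n} :=
  unit_span (fun i j => (i <= j)%N && same_block b i j).

Definition traceless : {vspace 'M[K]_n} :=
  lker (linfun (mxtrace : 'M[K]_n -> K^o)).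

Definition seaweed_space a b : {vspace 'M[K]_n} :=
  ((lower_block a + upper_block b) :&: traceless)%VS.

Definition seaweed_pos a b : rel 'I_n := fun i j =>
  (j <= i)%N && same_block a i j || (i <= j)%N && same_block b i j.

Lemma memv_traceless A : (A \in traceless) = (\tr A == 0).
Proof. by rewrite memv_ker lfunE. Qed.

Lemma memv_seaweed a b A : A \in seaweed_space a b <->
  \tr A = 0 /\ forall i j, ~~ seaweed_pos a b i j -> A i j = 0.
Proof.
rewrite memv_cap memv_traceless; split.
  case/andP=> /memv_addP[B memB [C memC ->]] /eqP tr0; split=> // i j.
  rewrite negb_or => /andP[nl nu]; rewrite mxE.
  move/memv_unit_span: memB => -> //; move/memv_unit_span: memC => -> //.
  by rewrite addr0.
case=> -> A0; rewrite eqxx andbT.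
pose P := (fun i j : 'I_n => (j <= i)%N && same_block a i j).
pose B := \matrix_(i, j) (if P i j then A i j else 0).
rewrite -(subrK B A) addrC memv_add //; apply/memv_unit_span => i j.
  by rewrite mxE /P => /negPf ->.
move=> nu; rewrite !mxE; case: ifPn => [_|nl]; first by rewrite subrr.
by rewrite subr0 A0 // negb_or nl.
Qed.

Lemma seaweed_pos_trans a b : transitive (seaweed_pos a b).
Proof.
rewrite /seaweed_pos => j i k.
case/orP=> /andP[ij sij] /orP[] /andP[jk sjk].
- by rewrite (leq_trans jk ij) (same_block_trans sij sjk).
- case: (leqP k i) => [ki | /ltnW ik].
    have kj : (j <= k <= i)%N by rewrite jk.
    rewrite same_block_sym in sij.
    by case/andP: (same_block_convex kj sij) => _; rewrite same_block_sym => ->.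
  have kj : (j <= i <= k)%N by rewrite ij.
  by case/andP: (same_block_convex kj sjk) => _ ->; rewrite ik.
- case: (leqP k i) => [ki | /ltnW ik].
    have kj : (k <= i <= j)%N by rewrite ki.
    rewrite same_block_sym in sjk.
    by case/andP: (same_block_convex kj sjk); rewrite same_block_sym => ->.
  have kj : (i <= k <= j)%N by rewrite ik.
  by case/andP: (same_block_convex kj sij) => ->; rewrite ik.
- by rewrite (leq_trans ij jk) (same_block_trans sij sjk) orbT.
Qed.

Definition commutator A B : 'M[K]_n := A *m B - B *m A.

Lemma seaweed_commutator a b A B :
    A \in seaweed_space a b -> B \in seaweed_space a b ->
  commutator A B \in seaweed_space a b.
Proof.
move=> /memv_seaweed[_ A0] /memv_seaweed[_ B0]; apply/memv_seaweed; split.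
  by rewrite raddfB /= mxtrace_mulC subrr.
have mul0 (C D : 'M[K]_n) : (forall i j, ~~ seaweed_pos a b i j -> C i j = 0) ->
    (forall i j, ~~ seaweed_pos a b i j -> D i j = 0) ->
    forall i j, ~~ seaweed_pos a b i j -> (C *m D) i j = 0.
  move=> C0 D0 i j nij; rewrite mxE big1 // => k _.
  have [ik|/C0->] := boolP (seaweed_pos a b i k); last by rewrite mul0r.
  rewrite D0 ?mulr0 //; apply: contra nij; exact: seaweed_pos_trans ik.
by move=> i j nij; rewrite mxE mul0 // mxE mul0 // subrr.
Qed.

Definition seaweed a b : Type := subvs_of (seaweed_space a b).
HB.instance Definition _ a b := Vector.copy (seaweed a b)
  (subvs_of (seaweed_space a b)).

Definition seaweed_lie a b (x y : seaweed a b) : seaweed a b :=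
  Subvs (seaweed_commutator (subvsP x) (subvsP y)).

Lemma seaweed_lie_linearr a b (x : seaweed a b) : linear (seaweed_lie x).
Proof.
move=> c y z; apply: val_inj; rewrite /= /commutator.
rewrite mulmxDr mulmxDl -scalemxAr -scalemxAl scalerBr.
by rewrite opprD addrACA.
Qed.

Lemma seaweed_lie_linearl a b (y : seaweed a b) : linear (@seaweed_lie a b ^~ y).
Proof.
move=> c x z; apply: val_inj; rewrite /= /commutator.
rewrite mulmxDr mulmxDl -scalemxAr -scalemxAl scalerBr.
by rewrite opprD addrACA.
Qed.

Lemma seaweed_liexx a b (x : seaweed a b) : seaweed_lie x x = 0.
Proof. by apply: val_inj; rewrite /= /commutator subrr. Qed.

Lemma seaweed_lie_jacobi a b (x y z : seaweed a b) :
  seaweed_lie x (seaweed_lie y z) + seaweed_lie y (seaweed_lie z x)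
    + seaweed_lie z (seaweed_lie x y) = 0.
Proof.
apply: val_inj; rewrite /= /commutator; move: (vsval x) (vsval y) (vsval z).
move=> A B C; rewrite !mulmxBr !mulmxBl !mulmxA !opprB.
move: (A *m B *m C) (A *m C *m B) (B *m A *m C) (B *m C *m A)
  (C *m A *m B) (C *m B *m A) => *.
by apply/matrixP=> i j; rewrite !mxE; ring.
Qed.

HB.instance Definition _ a b := Vector_isLie.Build K (seaweed a b)
  (@seaweed_lie_linearr a b) (@seaweed_lie_linearl a b) (@seaweed_liexx a b)
  (@seaweed_lie_jacobi a b).

End Seaweed.

(* Main.v *)
Require Import Defs.
From HB Require Import structures.
From mathcomp Require Import all_boot all_order all_algebra all_fingroup.
From mathcomp Require Import complex boolp reals ring zify.

(** Call an element a kernel element of a form phi when it lies in the kernel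
    of the Kirillov form of phi, and call phi regular when this kernel is
    a line.

    Being contact means that some phi has no nonzero kernel element on which
    phi itself vanishes, in odd dimension. One half is linear algebra: if z is
    a nonzero kernel element and phi z = 0, then phi /\ (d phi)^k is an
    alternating form of top degree that vanishes as soon as one argument is z,
    hence it is zero ([alternating_form_eq0], [contact_kernel]); conversely,
    evaluated on a kernel element followed by a symplectic sequence of lker phi
    it is a nonzero multiple of a product of nonzero pairings
    ([skew_pairing_vector_exists], [contact_of_kernel]). So a contact Lie
    algebra has index at most 1, and exactly 1 since the dimension is odd
    ([contact_index]).

    Let now the seaweed g have index 1. A regular phi with kernel spanned by x
    can fail to be contact only if phi x = 0. Suppose that the matrix x
    satisfies x^2 <> 0. The kernel of phi is, up to scalar matrices, an
    associative algebra, so that x^2 is a combination of x and 1, and as x has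
    trace 0 this forces tr (x^2) <> 0. Then y |-> tr (x y) vanishes on
    [x, g] but not at x, and adding a generic multiple of it to phi gives
    a contact form ([contact_of_square]).

    If g is not contact, every regular phi therefore has a kernel element of
    square zero. This survives in the limit: moving along a pencil of forms,
    with a kernel vector that is polynomial in the parameter, every form phi0,
    regular or not, gets a nonzero kernel element of square zero
    ([kernel_limit]).

    It remains to exhibit one phi0 = tr (F .) whose kernel contains no nonzero
    element of square zero ([seaweed_has_reduced_stabilizer]). Here F is
    found by an induction on the two compositions that follows the
    contraction moves on meander graphs: with a_1 <= b_1, either the two first
    blocks are equal and split off, or F matches the first positions of the
    block b_1 with its last ones, and the stabilizer of F maps injectively and
    multiplicatively to the stabilizer for a smaller seaweed. *)

Set Implicit Arguments.
Unset Strict Implicit.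
Unset Printing Implicit Defensive.

Import Order.TTheory GRing.Theory Num.Theory.
Local Open Scope ring_scope.

(** * Permutations and antisymmetrization *)

Section Permutations.

Fixpoint shift_perm p q (r : 'S_q) : 'S_(p + q) :=
  if p is p'.+1 then lift_perm ord0 ord0 (shift_perm p' r) else r.

Lemma shift_perm_rshift p q (r : 'S_q) j : shift_perm p r (rshift p j) = rshift p (r j).
Proof.
elim: p => [|p IHp] /=.
  by rewrite (_ : rshift 0 j = j); apply: val_inj.
have rshiftS i : rshift p.+1 i = lift ord0 (rshift p i) :> 'I_(p.+1 + q).
  exact: val_inj.
by rewrite !rshiftS lift_perm_lift IHp.
Qed.

Lemma shift_perm_lshift p q (r : 'S_q) i : shift_perm p r (lshift q i) = lshift q i.
Proof.
elim: p i => [[]//|p IHp] i /=; have [j ->|->] := unliftP ord0 i.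
  rewrite (_ : lshift q (lift ord0 j) = lift ord0 (lshift q j)); last exact: val_inj.
  by rewrite lift_perm_lift IHp.
by rewrite (_ : lshift q ord0 = ord0) ?lift_perm_id //; apply: val_inj.
Qed.

Lemma odd_shift_perm p q (r : 'S_q) : shift_perm p r = r :> bool.
Proof. by elim: p => //= p IHp; rewrite odd_lift_perm. Qed.

Lemma sum_perm_fix0 (V : nmodType) q (F : 'S_q.+1 -> V) :
  \sum_(s : 'S_q.+1 | s ord0 == ord0) F s =
  \sum_(r : 'S_q) F (lift_perm ord0 ord0 r).
Proof.
have lift_inj0 : injective (@lift_perm q ord0 ord0).
  move=> r t eq_rt; apply/permP => j; apply: (@lift_inj _ ord0).
  by rewrite -!(lift_perm_lift ord0 ord0) eq_rt.
rewrite -(big_imset F (in2W lift_inj0)) /=; apply: eq_bigl => s.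
apply/eqP/imsetP => [s0|[r _ ->]]; last by rewrite lift_perm_id.
have /fin_all_exists[g gP] j : exists i, s (lift ord0 j) = lift ord0 i.
  case: (unliftP ord0 (s (lift ord0 j))) => [i ->|]; first by exists i.
  by rewrite -[in RHS]s0 => /perm_inj/eqP; rewrite eq_sym (negPf (neq_lift _ _)).
have g_inj : injective g.
  by move=> i j eq_g; apply: (@lift_inj _ ord0); apply: (@perm_inj _ s); rewrite !gP eq_g.
exists (perm g_inj) => //; apply/permP => i.
have [j ->|->] := unliftP ord0 i; last by rewrite lift_perm_id s0.
by rewrite lift_perm_lift permE gP.
Qed.

End Permutations.

Section TopForms.
Variables (K : numFieldType) (L : lieAlgType K).

Definition tensor p q (f : cochain L p) (g : cochain L q) : cochain L (p + q) :=
  fun v => f (fun i => v (lshift q i)) * g (fun j => v (rshift p j)).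

Definition antisym p (f : cochain L p) : cochain L p :=
  fun v => \sum_(s : 'S_p) (-1) ^+ s * f (fun i => v (s i)).

Lemma wedgeE p q (f : cochain L p) (g : cochain L q) v :
  wedge f g v = (p`! * q`!)%:R^-1 * antisym (tensor f g) v.
Proof.
by rewrite /wedge; congr (_ * _); apply: eq_bigr => s _; rewrite -mulrA.
Qed.

Lemma antisym_perm p (f : cochain L p) v (r : 'S_p) :
  antisym f (fun i => v (r i)) = (-1) ^+ r * antisym f v.
Proof.
rewrite /antisym mulr_sumr [RHS](reindex_inj (mulIg r)); apply: eq_bigr => s _.
rewrite odd_permM signr_addb -[X in _ = _ * X]mulrA [RHS]mulrCA signrMK.
by congr (_ * f _); apply: funext => i; rewrite permM.
Qed.

(** The inner antisymmetrization can be absorbed in the outer one, because each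
    permutation of the last q slots extends to all p + q slots with the same
    sign. This is what flattens iterated wedge products. *)
Lemma antisym_tensor p q (f : cochain L p) (g : cochain L q) v :
  antisym (tensor f (antisym g)) v = q`!%:R * antisym (tensor f g) v.
Proof.
transitivity (\sum_(r : 'S_q) antisym (tensor f g) v); last first.
  by rewrite sumr_const mulr_natl (eq_card (B := {: 'S_q})) ?card_Sn.
rewrite [LHS]/antisym; under eq_bigr => s _ do rewrite /tensor /antisym !mulr_sumr.
rewrite exchange_big; apply: eq_bigr => r _.
rewrite [RHS](reindex_inj (mulgI (shift_perm p r))); apply: eq_bigr => s _.
rewrite odd_permM odd_shift_perm signr_addb [X in X * tensor _ _ _]mulrC -[RHS]mulrA.
congr (_ * _); rewrite mulrCA; congr (_ * (f _ * g _)); apply: funext => i.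
  by rewrite permM shift_perm_lshift.
by rewrite permM shift_perm_rshift.
Qed.

Fixpoint tensor_pow (f : cochain L 2) k : cochain L k.*2 :=
  if k is k'.+1 then tensor f (@tensor_pow f k') else fun=> 1.
Arguments tensor_pow : clear implicits.

Lemma antisym0 (f : cochain L 0) v : antisym f v = f v.
Proof.
rewrite /antisym (big_pred1 1%g) => [|s]; last first.
  by apply/esym/eqP/permP => -[].
by rewrite odd_perm1 mul1r; congr (f _); apply: funext => -[].
Qed.

(** Up to a nonzero factor, the k-th wedge power of a 2-form is the sum over all
    permutations of products of k pairings, like a Pfaffian. This form treats
    all k factors alike, unlike the nested definition of the power. *)
Lemma wedge_powE (f : cochain L 2) k : exists2 c : K, c != 0 &
  forall v, @wedge_pow K L f k v = c * antisym (tensor_pow f k) v.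
Proof.
elim: k => [|k [c c0 IHk]].
  by exists 1; rewrite ?oner_eq0 // => v; rewrite antisym0 mul1r.
exists ((2`! * k.*2`!)%:R^-1 * (c * k.*2`!%:R)).
  by rewrite !mulf_neq0 ?invr_eq0 ?pnatr_eq0 -?lt0n ?muln_gt0 ?fact_gt0.
move=> v; rewrite [LHS]wedgeE -2!mulrA; congr (_ * _).
rewrite -[X in c * X](antisym_tensor f) /antisym mulr_sumr; apply: eq_bigr => s _.
by rewrite [RHS]mulrCA /tensor; congr (_ * _); rewrite [RHS]mulrCA; congr (_ * _); apply: IHk.
Qed.

Implicit Types (f : cochain L 2) (k : nat).

Definition skew f := forall v, f (fun i => v (rev_ord i)) = - f v.

(** Permutations that reorder the k pairs have this property, and so has the flip
    of a pair when f is skew: they are the repetitions in the Pfaffian sum. *)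
Definition pairing_sym f k (h : 'S_k.*2) := forall u : 'I_k.*2 -> L,
  tensor_pow f k (fun i => u (h i)) = (-1) ^+ h * tensor_pow f k u.

Lemma pairing_symM f k (h h' : 'S_k.*2) :
  pairing_sym f h -> pairing_sym f h' -> pairing_sym f (h * h')%g.
Proof.
move=> symh symh' u; rewrite odd_permM signr_addb -mulrA -symh' -symh.
by congr (tensor_pow f k _); apply: funext => i; rewrite permM.
Qed.

Lemma pairing_sym_shift f k (h : 'S_k.*2) :
  pairing_sym f h -> @pairing_sym f k.+1 (shift_perm 2 h).
Proof.
move=> symh u; rewrite [odd_perm _](odd_shift_perm 2 h) /= /tensor mulrCA -symh.
congr (f _ * tensor_pow f k _); apply: funext => i.
  by rewrite (shift_perm_lshift (p := 2)).
by rewrite (shift_perm_rshift 2).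
Qed.

Lemma pairing_sym_flip f k : skew f ->
  @pairing_sym f k.+1 (tperm ord0 (lift ord0 ord0)).
Proof.
move=> skf u; rewrite odd_tperm /= expr1 mulN1r /tensor -mulNr.
congr (_ * tensor_pow f k _).
  rewrite -skf; congr (f _); apply: funext => i; congr (u _).
  by case: i => [[|[|//]] ?]; rewrite permE /=; apply: val_inj.
by apply: funext => i; rewrite tpermD.
Qed.

Lemma pairing_sym_swap f k (i0 := ord0 : 'I_k.+2.*2) (i1 := lift ord0 ord0 : 'I_k.+2.*2)
    (i2 := rshift 2 ord0 : 'I_k.+2.*2) (i3 := rshift 3 ord0 : 'I_k.+2.*2) :
  @pairing_sym f k.+2 (tperm i0 i2 * tperm i1 i3)%g.
Proof.
move=> u; rewrite odd_permM !odd_tperm /= expr0 mul1r /tensor.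
rewrite mulrCA; congr (f _ * (f _ * tensor_pow f k _)); apply: funext => i;
  congr (u _); rewrite permM.
- by case: i => [[|[|//]] ?]; rewrite !permE /=; apply: val_inj.
- by case: i => [[|[|//]] ?]; rewrite !permE /=; apply: val_inj.
- by rewrite !tpermD.
Qed.

(** Reordering pairs and flipping one of them brings any slot to the front. *)
Lemma pairing_sym_transitive f k (p : 'I_k.+1.*2) : skew f ->
  exists2 h : 'S_k.+1.*2, pairing_sym f h & h ord0 = p.
Proof.
move=> skf; elim: k p => [|k IHk] p.
  have [j ->|->] := unliftP ord0 p; last first.
    by exists 1%g; rewrite ?perm1 // => u; rewrite odd_perm1 mul1r;
      congr (tensor_pow f _ _); apply: funext => i; rewrite perm1.
  exists (tperm ord0 (lift ord0 ord0)); first exact: pairing_sym_flip.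
  by rewrite tpermL; apply: val_inj; case: j => [[]].
have [j ->|->] := unliftP ord0 p; last first.
  by exists 1%g; rewrite ?perm1 // => u; rewrite odd_perm1 mul1r;
    congr (tensor_pow f _ _); apply: funext => i; rewrite perm1.
have [i ->|->] := unliftP ord0 j; last first.
  exists (tperm ord0 (lift ord0 ord0)); first exact: pairing_sym_flip.
  by rewrite tpermL.
have [h symh h0] := IHk i.
exists (tperm ord0 (rshift 2 ord0 : 'I_k.+2.*2) *
  tperm (lift ord0 ord0) (rshift 3 ord0 : 'I_k.+2.*2) * shift_perm 2 h)%g.
  by apply: pairing_symM; [exact: pairing_sym_swap | exact: pairing_sym_shift].
rewrite !permM tpermL tpermD // (shift_perm_rshift 2) h0; exact: val_inj.
Qed.

(** * Kirillov forms and contact forms *)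
Section KirillovForm.
Variable phi : 'Hom(L, K^o).
Implicit Types x y z : L.

Lemma kirillovDr x y z : phi (lie x (y + z)) = phi (lie x y) + phi (lie x z).
Proof. by have := lie_linearr x 1 y z; rewrite !scale1r => ->; rewrite linearD. Qed.

Lemma kirillov0r x : phi (lie x 0) = 0.
Proof. by apply: (addrI (phi (lie x 0))); rewrite -kirillovDr !addr0. Qed.

Lemma kirillovZr c x y : phi (lie x (c *: y)) = c * phi (lie x y).
Proof.
by have := lie_linearr x c y 0; rewrite addr0 => ->; rewrite linearP /= kirillov0r addr0.
Qed.

Lemma kirillovDl x y z : phi (lie (x + y) z) = phi (lie x z) + phi (lie y z).
Proof. by have := lie_linearl z 1 x y; rewrite !scale1r => ->; rewrite linearD. Qed.

Lemma kirillov_anti x y : phi (lie x y) = - phi (lie y x).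
Proof.
have := congr1 phi (liexx (x + y)); rewrite linear0 kirillovDl !kirillovDr.
by rewrite !liexx linear0 add0r addr0 => /eqP; rewrite addr_eq0 => /eqP.
Qed.

Lemma kirillovBr x y z : phi (lie x (y - z)) = phi (lie x y) - phi (lie x z).
Proof. by rewrite kirillovDr -scaleN1r kirillovZr mulN1r. Qed.

End KirillovForm.

Lemma skew_d_one_form (phi : 'Hom(L, K^o)) : skew (d_one_form phi).
Proof.
move=> v; rewrite /d_one_form kirillov_anti.
by do 2!congr (- _); congr (phi (lie (v _) (v _))); apply: val_inj.
Qed.

(** Expansion of a Pfaffian along its first row when that row has at most one
    nonzero entry. By the transitivity above, each of the 2k + 2 slots in which the
    first vector may land contributes the same amount. *)
Lemma antisym_pairing_step (phi : 'Hom(L, K^o)) k (v : 'I_k.+1.*2 -> L) :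
    (forall j : 'I_k.*2, phi (lie (v ord0) (v (rshift 2 j))) = 0) ->
  antisym (tensor_pow (d_one_form phi) k.+1) v =
    k.+1.*2%:R * (d_one_form phi (fun i => v (lshift k.*2 i)) *
      antisym (tensor_pow (d_one_form phi) k) (fun j => v (rshift 2 j))).
Proof.
set f := d_one_form phi => v0_perp.
pose F (s : 'S_k.+1.*2) : K := (-1) ^+ s * tensor_pow f k.+1 (fun i => v (s i)).
have sum_at p : \sum_(s : 'S_k.+1.*2 | (s^-1)%g ord0 == p) F s =
    \sum_(s : 'S_k.+1.*2 | s ord0 == ord0) F s.
  have [h symh h0] := pairing_sym_transitive p (skew_d_one_form phi).
  rewrite (reindex_inj (mulgI h^-1%g)); apply: eq_big => s.
    rewrite invMg invgK permM -h0 (inj_eq perm_inj).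
    by rewrite -[LHS](inj_eq (@perm_inj _ s)) permKV eq_sym.
  move=> _; rewrite /F odd_permM odd_permV signr_addb -mulrA mulrCA; congr (_ * _).
  rewrite -symh; congr (tensor_pow f _ _); apply: funext => i.
  by rewrite permM permK.
rewrite /antisym (partition_big (fun s : 'S_k.+1.*2 => (s^-1)%g ord0) xpredT) //=.
rewrite (eq_bigr _ (fun p _ => sum_at p)) sumr_const card_ord [RHS]mulr_natl; congr (_ *+ _).
rewrite (sum_perm_fix0 (q := k.*2.+1)) (bigID (fun r : 'S_k.*2.+1 => r ord0 == ord0)) /=.
rewrite [X in _ + X]big1 ?addr0 => [|r r0]; last first.
  have [j r0j] : exists j, r ord0 = lift ord0 j.
    by case: (unliftP ord0 (r ord0)) r0 => [j ->|->]; [exists j | rewrite eqxx].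
  rewrite /F /= /tensor /f /d_one_form.
  have -> : lshift k.*2 (ord0 : 'I_2) = ord0 :> 'I_k.*2.+2 by apply: val_inj.
  have -> : lshift k.*2 (ord_max : 'I_2) = lift ord0 ord0 :> 'I_k.*2.+2.
    exact: val_inj.
  rewrite lift_perm_id lift_perm_lift r0j.
  have -> : lift ord0 (lift ord0 j) = rshift 2 j :> 'I_k.*2.+2 by apply: val_inj.
  by rewrite v0_perp oppr0 mul0r mulr0.
rewrite sum_perm_fix0 mulr_sumr; apply: eq_bigr => t _.
rewrite /F !odd_lift_perm /= [RHS]mulrCA; congr (_ * (f _ * tensor_pow f k _)).
  apply: funext => i; congr (v _).
  exact: (@shift_perm_lshift 2 _ t i).
apply: funext => i; congr (v _).
exact: (@shift_perm_rshift 2 _ t i).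
Qed.

(** Symplectic Gram-Schmidt: a hyperbolic pair u, w splits off from U, and what
    is orthogonal to both is again nondegenerate. Evenness of the dimension
    comes out of the same induction. *)
Lemma skew_pairing_vector_exists (phi : 'Hom(L, K^o)) (U : {vspace L}) :
    (forall u, u \in U -> (forall w, w \in U -> phi (lie u w) = 0) -> u = 0) ->
  exists k (v : 'I_k.*2 -> L), [/\ \dim U = k.*2, (forall i, v i \in U) &
    antisym (tensor_pow (d_one_form phi) k) v != 0].
Proof.
have [N] := ubnP (\dim U); elim: N U => // N IHN U ltN nondegU.
have [U0|[u uU u0]] : U = 0%VS \/ exists2 u, u \in U & u != 0.
  have [->|nzU] := eqVneq U 0%VS; first by left.
  by right; exists (vpick U); rewrite ?memv_pick ?vpick0.
  exists 0%N, (fun=> 0); rewrite U0 dimv0 antisym0 oner_eq0; split=> // i; apply: mem0v.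
have [w wU uw] : exists2 w, w \in U & phi (lie u w) != 0.
  apply: contrapT => noW; move/eqP: u0; apply; apply: nondegU => // w wU.
  by apply: contrapT => /eqP uw; apply: noW; exists w.
pose perp y : {vspace L} := lker (kirillov_flat phi y).
pose U' := (U :&: perp u :&: perp w)%VS.
have memU' y : (y \in U') = [&& y \in U, phi (lie u y) == 0 & phi (lie w y) == 0].
  by rewrite !memv_cap !memv_ker !kirillov_flatE andbA.
have uu y : phi (lie y y) = 0 by rewrite liexx linear0.
have wu : phi (lie w u) = - phi (lie u w) by rewrite kirillov_anti.
(* Subtracting suitable multiples of u and w makes y orthogonal to both. *)
have decU y : y \in U -> exists a b, y - a *: u - b *: w \in U'.
  move=> yU; exists (- phi (lie w y) / phi (lie u w)), (phi (lie u y) / phi (lie u w)).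
  rewrite memU' !rpredB ?rpredZ //= !kirillovBr !kirillovZr !uu wu.
  by apply/andP; split; apply/eqP; field.
have U'u : (U' :&: <[u]> = 0)%VS.
  apply/eqP; rewrite -subv0; apply/subvP => y; rewrite memv_cap memv0.
  case/andP=> + /vlineP[a yE]; rewrite memU' yE !kirillovZr uu wu mulr0.
  by rewrite eqxx mulrN oppr_eq0 mulf_eq0 (negPf uw) orbF => /andP[_ /eqP->]; rewrite scale0r.
have U'uw : ((U' + <[u]>) :&: <[w]> = 0)%VS.
  apply/eqP; rewrite -subv0; apply/subvP => y; rewrite memv_cap memv0.
  case/andP=> /memv_addP[y' + [_ /vlineP[a ->] yE]] /vlineP[b yE'].
  rewrite memU' => /and3P[_ /eqP uy' _].
  have : phi (lie u (b *: w)) == 0.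
    by rewrite -yE' yE kirillovDr kirillovZr uy' uu mulr0 addr0.
  rewrite kirillovZr mulf_eq0 (negPf uw) orbF => /eqP b0.
  by rewrite yE' b0 scale0r.
have w0 : w != 0 by apply: contraNneq uw => ->; rewrite kirillov0r.
have UE : U = (U' + <[u]> + <[w]>)%VS.
  apply/eqP; rewrite eqEsubv !subv_add -!memvE uU wU !andbT; apply/andP; split.
    apply/subvP => y /decU[a [b yU']].
    rewrite -(subrK (b *: w) y) memv_add ?memvZ ?memv_line //.
    by rewrite -(subrK (a *: u) (y - _)) memv_add ?memvZ ?memv_line // addrAC.
  by apply/subvP => y; rewrite memU' => /and3P[].
have dimU : \dim U = (\dim U').+2.
  by rewrite UE !dimv_disjoint_sum // !dim_vline u0 w0 !addn1.
have [|y yU' y_perp|k [v [dimU' vU' v0]]] := IHN U'; first by lia.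
  have /and3P[yU /eqP uy /eqP wy] : [&& y \in U, phi (lie u y) == 0 & phi (lie w y) == 0].
    by rewrite -memU'.
  apply: nondegU => // z /decU[a [b zU']].
  have := y_perp _ zU'; rewrite !kirillovBr !kirillovZr.
  rewrite [phi (lie y u)]kirillov_anti [phi (lie y w)]kirillov_anti uy wy.
  by rewrite !oppr0 !mulr0 !subr0.
pose v2 (i : 'I_2 + 'I_k.*2) :=
  match i with inl j => if j == ord0 then u else w | inr j => v j end.
have v2l j : v2 (split (lshift k.*2 j)) = if j == ord0 then u else w.
  by rewrite -[lshift _ _]/(unsplit (inl j)) unsplitK.
have v2r j : v2 (split (rshift 2 j)) = v j.
  by rewrite -[rshift _ _]/(unsplit (inr j)) unsplitK.
exists k.+1, (fun i : 'I_(2 + k.*2) => v2 (split i)); split.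
- by rewrite dimU dimU'.
- move=> i; rewrite /v2; case: (@split 2 k.*2 i) => [j|j]; first by case: ifP.
  by have := vU' j; rewrite memU' => /and3P[].
rewrite antisym_pairing_step => [|j].
  rewrite mulf_neq0 ?pnatr_eq0 // mulf_neq0 //.
    by rewrite /d_one_form !v2l oppr_eq0.
  by rewrite (_ : (fun j => _) = v) //; apply: funext.
have := vU' j; rewrite memU' v2r => /and3P[_ /eqP <- _]; congr (phi (lie _ _)).
by rewrite -[RHS](v2l ord0); congr (v2 (split _)); apply: val_inj.
Qed.

(** The top form is evaluated on x followed by a symplectic sequence of lker phi.
    As phi vanishes on the latter, only the permutations fixing the first slot
    contribute, and what is left is the Pfaffian of the sequence. *)
Lemma contact_of_kernel (phi : 'Hom(L, K^o)) x : (forall y, phi (lie x y) = 0) ->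
    phi x != 0 -> (forall y, (forall z, phi (lie y z) = 0) -> phi y = 0 -> y = 0) ->
  contact L.
Proof.
move=> x_ker x0 ker_inj.
have decomp y : y - (phi y / phi x) *: x \in lker phi.
  by rewrite memv_ker linearB linearZ /= -[_ *: _]/(_ * _) divfK // subrr.
have [y y_ker y_perp|k [v [dimk v_ker v0]]] :=
  @skew_pairing_vector_exists phi (lker phi).
  apply: ker_inj => [z|]; last by apply/eqP; rewrite -memv_ker.
  have := y_perp _ (decomp z); rewrite kirillovBr kirillovZr.
  by rewrite [phi (lie y x)]kirillov_anti x_ker oppr0 mulr0 subr0.
exists k; split.
  have -> : fullv = (lker phi + <[x]>)%VS.
    apply/eqP; rewrite eqEsubv subvf andbT; apply/subvP => y _.
    by rewrite -(subrK ((phi y / phi x) *: x) y) memv_add ?memvZ ?memv_line.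
  rewrite dimv_disjoint_sum ?dimk ?dim_vline; last first.
    apply/eqP; rewrite -subv0; apply/subvP => y; rewrite memv_cap memv0.
    case/andP=> + /vlineP[a yE]; rewrite memv_ker yE linearZ /= -[_ *: _]/(_ * _).
    by rewrite mulf_eq0 (negPf x0) orbF => /eqP->; rewrite scale0r.
  by rewrite (_ : x != 0) ?addn1 //; apply: contraNneq x0 => ->; rewrite linear0.
exists phi => W0.
pose u (i : 'I_(1 + k.*2)) := if split i is inr j then v j else x.
have ur j : u (rshift 1 j) = v j.
  by rewrite /u -[rshift _ _]/(unsplit (inr j)) unsplitK.
have u0 : u ord0 = x.
  by rewrite /u; case: splitP => // j; case: j.
have [c c0 powE] := @wedge_powE (d_one_form phi) k.
have /eqP := congr1 (@^~ u) W0; rewrite wedgeE mulf_eq0.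
rewrite invr_eq0 pnatr_eq0 muln_eq0 !(gtn_eqF (fact_gt0 _)) /= => /eqP.
have -> : antisym (tensor (one_form phi) (@wedge_pow K L (d_one_form phi) k)) u =
    c * antisym (tensor (one_form phi) (antisym (tensor_pow (d_one_form phi) k))) u.
  rewrite /antisym mulr_sumr; apply: eq_bigr => s _; rewrite [RHS]mulrCA; congr (_ * _).
  by rewrite /tensor [RHS]mulrCA; congr (_ * _); apply: powE.
rewrite antisym_tensor => /eqP; rewrite !mulf_eq0 (negPf c0) pnatr_eq0.
rewrite (gtn_eqF (fact_gt0 _)) /=; apply/negP.
rewrite [antisym _ _](bigID (fun s : 'S_(1 + k.*2) => s ord0 == ord0)) /=.
rewrite [X in _ + X]big1 ?addr0 => [|s s0]; last first.
  rewrite /tensor /one_form (_ : lshift k.*2 (ord0 : 'I_1) = ord0 :> 'I_k.*2.+1); last exact: val_inj.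
  have [j ->|s0'] := unliftP ord0 (s ord0); last by rewrite s0' eqxx in s0.
  rewrite (_ : lift ord0 j = rshift 1 j :> 'I_k.*2.+1); last exact: val_inj.
  by move: (v_ker j); rewrite memv_ker ur => /eqP->; rewrite mul0r mulr0.
rewrite (sum_perm_fix0 (q := k.*2)).
rewrite (_ : \sum_(r : _) _ = phi x * antisym (tensor_pow (d_one_form phi) k) v).
  by rewrite mulf_neq0.
rewrite /antisym mulr_sumr; apply: eq_bigr => r _; rewrite odd_lift_perm /= [RHS]mulrCA.
congr (_ * _); rewrite /tensor /one_form (_ : lshift k.*2 (ord0 : 'I_1) = ord0 :> 'I_k.*2.+1); last exact: val_inj.
rewrite lift_perm_id u0; congr (_ * tensor_pow _ k _); apply: funext => j.
by rewrite -(ur (r j)); congr u; apply: (@shift_perm_rshift 1 _ r j).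
Qed.

Definition update p (v : 'I_p -> L) i u : 'I_p -> L := fun j => if j == i then u else v j.

Definition multilinear p (f : cochain L p) := forall v i c u w,
  f (update v i (c *: u + w)) = c * f (update v i u) + f (update v i w).

Definition vanishes_at z p (f : cochain L p) := forall v i, v i = z -> f v = 0.

Lemma multilinear_one_form phi : multilinear (one_form phi).
Proof.
by move=> v i c u w; rewrite /one_form /update (ord1 i) eqxx linearP.
Qed.

Lemma multilinear_d_one_form phi : multilinear (d_one_form phi).
Proof.
move=> v i c u w; rewrite /d_one_form /update.
case: i => [[|[|//]] ilt] /=.
  by rewrite !(kirillov_anti _ _ (v _)) kirillovDr kirillovZr; ring.
by rewrite kirillovDr kirillovZr; ring.
Qed.

Lemma vanishes_one_form (phi : 'Hom(L, K^o)) z : phi z = 0 -> vanishes_at z (one_form phi).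
Proof. by move=> phiz v i; rewrite (ord1 i) /one_form => ->. Qed.

Lemma vanishes_d_one_form (phi : 'Hom(L, K^o)) z : (forall y, phi (lie z y) = 0) ->
  vanishes_at z (d_one_form phi).
Proof.
move=> phiz v i; rewrite /d_one_form.
case: i => [[|[|//]] ilt] vi.
  by rewrite (_ : v ord0 = z) ?phiz ?oppr0 // -vi; congr v; apply: val_inj.
rewrite kirillov_anti (_ : v ord_max = z) ?phiz ?oppr0 //.
by rewrite -vi; congr v; apply: val_inj.
Qed.

Lemma update_perm p q (v : 'I_p -> L) i u (h : 'I_q -> 'I_p) : injective h ->
  forall j, h j = i -> (fun l => update v i u (h l)) = update (fun l => v (h l)) j u.
Proof.
by move=> h_inj j <-; apply: funext => k; rewrite /update (inj_eq h_inj).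
Qed.

Lemma update_notin p q (v : 'I_p -> L) i u (h : 'I_q -> 'I_p) :
  (forall j, h j != i) -> (fun l => update v i u (h l)) = (fun l => v (h l)).
Proof. by move=> hi; apply: funext => k; rewrite /update (negPf (hi k)). Qed.

Lemma multilinear_wedge p q (f : cochain L p) (g : cochain L q) :
  multilinear f -> multilinear g -> multilinear (wedge f g).
Proof.
move=> linf ling v i c u w; rewrite /wedge mulrCA -mulrDr; congr (_ * _).
rewrite mulr_sumr -big_split; apply: eq_bigr => s _ /=.
have lsh_inj : injective (fun j => s (lshift q j)).
  by move=> j k /perm_inj/lshift_inj.
have rsh_inj : injective (fun j => s (rshift p j)).
  by move=> j k /perm_inj/rshift_inj.
have [j sj|j sj] := split_ordP (s^-1%g i).
  have si : s (lshift q j) = i by rewrite -sj permKV.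
  have ri l : s (rshift p l) != i by rewrite -si (inj_eq perm_inj) eq_rlshift.
  rewrite !(update_perm _ _ lsh_inj si) !(update_notin _ _ ri) linf.
  by rewrite mulrDr mulrDl mulrCA !mulrA.
have si : s (rshift p j) = i by rewrite -sj permKV.
have li l : s (lshift q l) != i by rewrite -si (inj_eq perm_inj) eq_lrshift.
rewrite !(update_perm _ _ rsh_inj si) !(update_notin _ _ li) ling.
by rewrite mulrDr [X in X + _]mulrCA.
Qed.

Lemma vanishes_wedge z p q (f : cochain L p) (g : cochain L q) :
  vanishes_at z f -> vanishes_at z g -> vanishes_at z (wedge f g).
Proof.
move=> vf vg v i vi; rewrite /wedge big1 ?mulr0 // => s _.
have [j sj|j sj] := split_ordP (s^-1%g i).
  by rewrite (vf _ j) ?mulr0 ?mul0r // -sj permKV.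
by rewrite (vg _ j) ?mulr0 // -sj permKV.
Qed.

Lemma wedge_perm p q (f : cochain L p) (g : cochain L q) v (s : 'S_(p + q)) :
  wedge f g (fun i => v (s i)) = (-1) ^+ s * wedge f g v.
Proof. by rewrite !wedgeE antisym_perm mulrCA. Qed.

(** The entries of v are linearly dependent, or they form a basis and z is
    a combination of them. In either case some entry v i is a combination of
    the other ones and of a vector at which f vanishes. *)
Lemma alternating_form_eq0 p (f : cochain L p.+1) z v :
    \dim {:L} = p.+1 -> multilinear f ->
    (forall u (s : 'S_p.+1), f (fun i => u (s i)) = (-1) ^+ s * f u) ->
    z != 0 -> vanishes_at z f -> f v = 0.
Proof.
move=> dimL linf altf z0 fz.
have f0 : vanishes_at 0 f.
  move=> u i ui; have := linf u i 1 0 0.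
  rewrite scaler0 addr0 mul1r (_ : update u i 0 = u).
    by move/eqP; rewrite -subr_eq0 opprD addrA subrr add0r oppr_eq0 => /eqP.
  by apply: funext => j; rewrite /update; case: eqP => // ->.
have f_rep u i j : i != j -> u i = u j -> f u = 0.
  move=> ij uij; have := altf u (tperm i j).
  rewrite (_ : (fun l => _) = u); last first.
    by apply: funext => k; case: tpermP => // ->.
  rewrite odd_tperm ij expr1 mulN1r => /eqP; rewrite -addr_eq0 -mulr2n.
  by rewrite -mulr_natl mulf_eq0 pnatr_eq0 => /eqP.
have f_sum u i (a : 'I_p.+1 -> K) (w : 'I_p.+1 -> L) :
    f (update u i (\sum_j a j *: w j)) = \sum_j a j * f (update u i (w j)).
  elim/big_rec2: _ => [|j _ t _ <-]; last exact: linf.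
  by apply: (f0 _ i); rewrite /update eqxx.
have dependent i a z' : a i != 0 -> vanishes_at z' f -> \sum_j a j *: v j = z' -> f v = 0.
  move=> ai fz' sumE; apply/eqP.
  have : a i * f v = 0.
    transitivity (f (update v i z')); last by apply: (fz' _ i); rewrite /update eqxx.
    rewrite -sumE f_sum (bigD1 i) //= big1 ?addr0 => [|j ji]; last first.
      by rewrite (f_rep _ i j) ?mulr0 ?[i == j]eq_sym // /update eqxx (negPf ji).
    congr (_ * f _); apply: funext => j; rewrite /update; by case: eqP => // ->.
  by move/eqP; rewrite mulf_eq0 (negPf ai).
apply: contrapT => fv0; pose X := [tuple v i | i < p.+1].
have X_i (i : 'I_p.+1) : X`_i = v i by rewrite -tnth_nth tnth_mktuple.
have freeX : free X.
  apply/freeP => a sum0 i; apply: contrapT => /eqP ai; apply: fv0.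
  apply: (dependent i a 0) => //.
  by rewrite -[RHS]sum0; apply: eq_bigr => j _; rewrite X_i.
have spanX : <<X>>%VS = fullv.
  by apply/eqP; rewrite eqEdim subvf dimL (eqP freeX) size_tuple leqnn.
have zE : z = \sum_i coord X i z *: v i.
  by rewrite [LHS](@coord_span _ _ _ X) ?spanX ?memvf //; apply: eq_bigr => i _; rewrite X_i.
have [i ci] : exists i, coord X i z != 0.
  apply: contrapT => c0; move/eqP: z0; apply; rewrite zE big1 // => i _.
  by apply/eqP; rewrite scaler_eq0; apply/orP; left; apply: contrapT => ci; apply: c0; exists i; apply/negP.
by apply: fv0; apply: (dependent i (fun j => coord X j z) z ci fz).
Qed.

Lemma contact_kernel : contact L -> exists k, \dim {:L} = k.*2.+1 /\
  exists phi : 'Hom(L, K^o),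
    forall z, (forall y, phi (lie z y) = 0) -> phi z = 0 -> z = 0.
Proof.
case=> k [dimL [phi W0]]; exists k; split=> //; exists phi => z z_ker phiz.
apply: contrapT => /eqP z0; apply: W0; apply: funext => v.
apply: (alternating_form_eq0 _ dimL _ _ z0).
- apply: (@multilinear_wedge 1 k.*2); first exact: multilinear_one_form.
  elim: (k) => [w []//|m IHm].
  by apply: (@multilinear_wedge 2 m.*2) => //; apply: multilinear_d_one_form.
- by move=> u s; apply: (@wedge_perm 1 k.*2).
- apply: (@vanishes_wedge _ 1 k.*2); first exact: vanishes_one_form.
  elim: (k) => [w []//|m IHm].
  by apply: (@vanishes_wedge _ 2 m.*2) => //; apply: vanishes_d_one_form.
Qed.

End TopForms.

(** * Kernels of Kirillov forms: index, regular forms, limits *)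

Section Kernels.
Variables (K : numFieldType) (L : lieAlgType K).
Implicit Types (phi delta : 'Hom(L, K^o)) (x y z : L).

Lemma kirillov_kerP phi x :
  x \in kirillov_ker phi <-> forall y, phi (lie x y) = 0.
Proof. exact: memv_kirillov_ker. Qed.

(** A form with trivial kernel would make the whole algebra symplectic, hence of
    even dimension. So all kernels are nonzero when the dimension is odd, and
    the kernel of a contact form embeds in the ground field by the form. *)
Lemma contact_index : contact L -> lie_index L = 1%N.
Proof.
case/contact_kernel=> k [dimL [phi phi_inj]].
have ker_gt0 (psi : 'Hom(L, K^o)) : (0 < \dim (kirillov_ker psi))%N.
  rewrite lt0n; apply/eqP => /eqP; rewrite dimv_eq0 => /eqP ker0.
  have [|m [v [+ _ _]]] := @skew_pairing_vector_exists _ _ psi fullv.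
    move=> u _ u_perp; apply/eqP; rewrite -memv0 -ker0.
    by apply/kirillov_kerP => y; apply: u_perp; rewrite memvf.
  by rewrite dimL; lia.
have ker_le1 : (\dim (kirillov_ker phi) <= 1)%N.
  have [-> |] := eqVneq (kirillov_ker phi) 0%VS; first by rewrite dimv0.
  rewrite -vpick0; set x := vpick _ => x0.
  have xker y : phi (lie x y) = 0 by move: y; apply/kirillov_kerP/memv_pick.
  have phix : phi x != 0 by apply: contraNneq x0 => /(phi_inj _ xker)->.
  suff /dimvS sub_x : (kirillov_ker phi <= <[x]>)%VS.
    by rewrite (leq_trans sub_x) // dim_vline leq_b1.
  apply/subvP => y /kirillov_kerP yker; apply/vlineP; exists (phi y / phi x).
  apply/eqP; rewrite -subr_eq0; apply/eqP/phi_inj => [z|].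
    rewrite kirillov_anti kirillovBr kirillovZr.
    by rewrite !(kirillov_anti _ z) yker xker oppr0 mulr0 subr0 oppr0.
  by rewrite linearB linearZ /= -[_ *: _]/(_ * _) divfK // subrr.
rewrite /lie_index; case: ex_minnP => m /asboolP[psi <-] min_m.
apply/eqP; rewrite eqn_leq ker_gt0 andbT (leq_trans _ ker_le1) //.
by apply: min_m; apply/asboolP; exists phi.
Qed.

Lemma index1_kernels : lie_index L = 1%N ->
  (exists phi, \dim (kirillov_ker phi) = 1%N) /\
  (forall phi, (0 < \dim (kirillov_ker phi))%N).
Proof.
rewrite /lie_index; case: ex_minnP => m /asboolP[phi ker_phi] min_m m1.
split=> [|psi]; first by exists phi; rewrite ker_phi.
by rewrite -m1; apply: min_m; apply/asboolP; exists psi.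
Qed.

Definition gram m (e : m.-tuple L) phi : 'M[K]_m :=
  \matrix_(i, j) phi (lie e`_i e`_j).

Lemma kirillov_sumr phi x I (r : seq I) (c : I -> K) (y : I -> L) :
  phi (lie x (\sum_(i <- r) c i *: y i)) = \sum_(i <- r) c i * phi (lie x (y i)).
Proof.
elim/big_rec2: _ => [|i _ s _ <-]; first exact: kirillov0r.
by rewrite kirillovDr kirillovZr.
Qed.

Lemma kirillov_suml phi x I (r : seq I) (c : I -> K) (y : I -> L) :
  phi (lie (\sum_(i <- r) c i *: y i) x) = \sum_(i <- r) c i * phi (lie (y i) x).
Proof.
rewrite kirillov_anti kirillov_sumr -sumrN; apply: eq_bigr => i _.
by rewrite kirillov_anti mulrN opprK.
Qed.

Lemma perp_span phi m (e : m.-tuple L) x : (forall i : 'I_m, phi (lie x e`_i) = 0) ->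
  forall y, y \in <<e>>%VS -> phi (lie x y) = 0.
Proof.
move=> xe y /coord_span->; rewrite kirillov_sumr big1 // => i _.
by rewrite xe mulr0.
Qed.

Lemma gram_mulmx phi m (e : m.-tuple L) (c : 'rV_m) j :
  (c *m gram e phi) 0 j = phi (lie (\sum_i c 0 i *: e`_i) e`_j).
Proof. by rewrite kirillov_suml mxE; apply: eq_bigr => i _; rewrite mxE. Qed.

(** Degeneracy on a subspace becomes the vanishing of a determinant, which is
    polynomial in the form; both semicontinuity statements below rest on it. *)
Lemma det_gram_eq0 phi m (e : m.-tuple L) : free e ->
  (\det (gram e phi) == 0) <->
  exists2 x, x != 0 & x \in <<e>>%VS /\ forall y, y \in <<e>>%VS -> phi (lie x y) = 0.
Proof.
move=> free_e; split=> [/det0P[c c0 cG] | [x x0 [xe x_perp]]].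
  exists (\sum_i c 0 i *: e`_i).
    apply: contra_neq c0 => c0; apply/rowP => i; rewrite mxE.
    exact: (elimT freeP free_e _ c0).
  split; first by apply: memv_suml => i _; rewrite memvZ // memv_span ?mem_nth ?size_tuple.
  apply: perp_span => j; rewrite -gram_mulmx cG mxE //.
apply/det0P; exists (\row_i coord e i x).
  apply: contra_neq x0 => /rowP c0; rewrite (coord_span xe) big1 // => i _.
  by have := c0 i; rewrite !mxE => ->; rewrite scale0r.
apply/rowP => j; rewrite gram_mulmx mxE.
rewrite (eq_bigr (fun i => coord e i x *: e`_i)) => [|i _]; last by rewrite mxE.
by rewrite -(coord_span xe) x_perp // memv_span ?mem_nth ?size_tuple.
Qed.

Definition pencil_gram m (e : m.-tuple L) phi delta : 'M[{poly K}]_m :=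
  map_mx polyC (gram e phi) + 'X *: map_mx polyC (gram e delta).

Lemma pencil_gramE m (e : m.-tuple L) phi delta t :
  map_mx (horner_eval t) (pencil_gram e phi delta) = gram e (phi + t *: delta).
Proof.
apply/matrixP => i j; rewrite !mxE /horner_eval !hornerE.
by rewrite add_lfunE scale_lfunE.
Qed.

Lemma det_pencil_gramE m (e : m.-tuple L) phi delta t :
  (\det (pencil_gram e phi delta)).[t] = \det (gram e (phi + t *: delta)).
Proof. by rewrite -pencil_gramE det_map_mx. Qed.

Lemma poly_nonroot (p : {poly K}) : p != 0 -> exists t, p.[t] != 0.
Proof.
move=> p0; apply: contrapT => all0.
have /(max_poly_roots p0) : all (root p) [seq i%:R | i <- iota 0 (size p)].
  apply/allP => t _; apply/negPn/negP => pt; apply: all0; exists t.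
  by rewrite rootE in pt.
rewrite size_map size_iota ltnn => H; suff : false by [].
apply: H; rewrite map_inj_uniq ?iota_uniq //.
by move=> i j /eqP; rewrite eqr_nat => /eqP.
Qed.

(** The kernel can only shrink under a generic deformation: D is the Gram
    determinant on a complement of the kernel at t1. *)
Lemma regular_pencil phi delta t1 :
    (\dim (kirillov_ker (phi + t1 *: delta)%R) <= 1)%N ->
  exists2 D : {poly K}, D != 0 & forall t, D.[t] != 0 ->
    (\dim (kirillov_ker (phi + t *: delta)%R) <= 1)%N.
Proof.
set phi1 := phi + _ => ker1; pose U := ((kirillov_ker phi1)^C)%VS.
exists (\det (pencil_gram (vbasis U) phi delta)).
  suff: (\det (pencil_gram (vbasis U) phi delta)).[t1] != 0.
    by apply: contraNneq => ->; rewrite horner0.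
  rewrite det_pencil_gramE; apply/negP => /det_gram_eq0.
  case=> [|x x0 [xU x_perp]]; first exact: basis_free (vbasisP U).
  move/eqP: x0; apply; apply/eqP; rewrite -memv0 -(capv_compl (kirillov_ker phi1)).
  rewrite (span_basis (vbasisP U)) in xU x_perp; rewrite memv_cap xU andbT.
  apply/kirillov_kerP => y; have := memvf y; rewrite -(addv_complf (kirillov_ker phi1)).
  case/memv_addP=> y1 /kirillov_kerP y1_ker [y2 y2U ->].
  by rewrite kirillovDr (x_perp y2) // addr0 kirillov_anti y1_ker oppr0.
(* The kernel meets U trivially, and U has codimension at most 1. *)
move=> t; rewrite det_pencil_gramE => Dt.
have capU : (kirillov_ker (phi + t *: delta)%R :&: U = 0)%VS.
  apply/eqP; rewrite -subv0; apply/subvP => x; rewrite memv_cap memv0.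
  case/andP=> /kirillov_kerP x_ker xU; apply: contraNT Dt => x0.
  apply/det_gram_eq0; first exact: basis_free (vbasisP U).
  by exists x => //; rewrite (span_basis (vbasisP U)); split=> // y _; apply: x_ker.
have dimU : \dim U = (\dim {:L} - \dim (kirillov_ker phi1))%N by apply: dimv_compl.
move: (kirillov_ker (phi + t *: delta)%R) capU => W capU.
have := dimvS (subvf (W + U)%VS); rewrite (dimv_disjoint_sum capU) dimU.
by have := dimvS (subvf (kirillov_ker phi1)); lia.
Qed.

(** For every t the vector x remains in the kernel of phi + t delta. For generic
    t that kernel is still a line, and phi x + t delta x is nonzero. *)
Lemma contact_of_regular phi delta x : kirillov_ker phi = <[x]>%VS -> x != 0 ->
  (forall y, delta (lie x y) = 0) -> delta x != 0 -> contact L.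
Proof.
move=> kerE x0 delta_x delta0.
have [|D D0 Dreg] := @regular_pencil phi delta 0.
  by rewrite scale0r addr0 kerE dim_vline x0.
pose P := D * ((phi x)%:P + (delta x)%:P * 'X).
have [|t] := @poly_nonroot P.
  rewrite mulf_neq0 //; apply/negP => /eqP/polyP/(_ 1%N).
  by rewrite !coefE => /eqP; rewrite add0r mulr1 (negPf delta0).
rewrite !hornerE mulf_eq0 negb_or => /andP[/Dreg reg_t phit_x].
pose phit := phi + t *: delta.
have phitE y : phit y = phi y + t * delta y by rewrite add_lfunE scale_lfunE.
have x_ker y : phit (lie x y) = 0.
  rewrite phitE delta_x mulr0 addr0; move: y; apply/kirillov_kerP.
  by rewrite kerE memv_line.
have phix : phit x != 0 by rewrite phitE mulrC addrC -(mulrC t) addrC // [t * _]mulrC.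
apply: (contact_of_kernel x_ker phix) => y y_ker phiy.
have /vlineP[c yE] : y \in <[x]>%VS.
  suff -> : (<[x]> = kirillov_ker phit)%VS by apply/kirillov_kerP.
  apply/eqP; rewrite eqEdim dim_vline x0 reg_t andbT -memvE.
  by apply/kirillov_kerP.
move: phiy; rewrite yE linearZ /= -[_ *: _]/(_ * _) => /eqP.
by rewrite mulf_eq0 (negPf phix) orbF => /eqP->; rewrite scale0r.
Qed.

(** Powers of the variable are divided out of a kernel vector with polynomial
    entries until it does not vanish at 0. *)
Lemma pencil_kernel_primitive m (M : 'M[{poly K}]_m) : \det M = 0 ->
  exists2 v : 'rV_m, v *m M = 0 & map_mx (horner_eval 0) v != 0.
Proof.
move/eqP/det0P => [v v0 vM].
have [j vj] : exists j, v 0 j != 0.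
  by apply: contrapT => no; move/eqP: v0; apply; apply/rowP => j; rewrite mxE;
    apply: contrapT => /eqP vj; apply: no; exists j.
have [N] := ubnP (size (v 0 j)); elim: N v {v0} vj vM => // N IHN v vj vM ltN.
have [v00|] := eqVneq (map_mx (horner_eval 0) v) 0; last by exists v.
have vX i : v 0 i = (v 0 i %/ 'X) * 'X.
  rewrite divpK // -['X]subr0 -polyC0 dvdp_XsubCl.
  by have /rowP/(_ i) := v00; rewrite !mxE => /eqP.
apply: (IHN (\row_i (v 0 i %/ 'X))).
- by apply: contra_neq vj; rewrite mxE => E; rewrite vX E mul0r.
- apply/rowP => i; have /rowP/(_ i) := vM; rewrite !mxE => vMi.
  apply: (mulfI (_ : 'X != 0)); first by rewrite polyX_eq0.
  rewrite mulr0 -[RHS]vMi mulr_sumr; apply: eq_bigr => k _.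
  by rewrite mxE [in RHS]vX mulrCA mulrA.
- rewrite mxE; move: ltN; rewrite [in X in X -> _]vX size_mulX //.
  by apply: contra_neq vj => E; rewrite vX E mul0r.
Qed.

(** Along the pencil from phi0 to phi1 there is a kernel vector x t that is
    polynomial in t with x 0 <> 0. For generic t the form is regular, so the
    quadratic conditions hold at x t; being polynomial in t, they hold at
    t = 0. *)
Lemma kernel_limit (I : Type) (Q : I -> L -> L -> K) phi0 phi1 :
    (forall i c x y z, Q i (c *: x + y) z = c * Q i x z + Q i y z) ->
    (forall i c x y z, Q i z (c *: x + y) = c * Q i z x + Q i z y) ->
    (forall phi, 0 < \dim (kirillov_ker phi))%N ->
    \dim (kirillov_ker phi1) = 1%N ->
    (forall phi x, \dim (kirillov_ker phi) = 1%N -> x \in kirillov_ker phi ->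
      forall i, Q i x x = 0) ->
  exists2 x, x != 0 & x \in kirillov_ker phi0 /\ forall i, Q i x x = 0.
Proof.
move=> Ql Qr ker_gt0 ker1 Q0; pose delta := phi1 - phi0.
pose e := vbasis (fullv : {vspace L}).
have free_e : free e by exact: basis_free (vbasisP _).
have span_e : <<e>>%VS = fullv by exact: span_basis (vbasisP _).
have [|v vM v0] := @pencil_kernel_primitive _ (pencil_gram e phi0 delta).
  apply/eqP/negPn/negP => /poly_nonroot[t]; apply/negP; rewrite negbK.
  rewrite det_pencil_gramE; apply/det_gram_eq0 => //.
  set psi := phi0 + _; exists (vpick (kirillov_ker psi)).
    by rewrite vpick0 -dimv_eq0 -lt0n.
  rewrite span_e memvf; split=> // y _; move: y.
  exact/kirillov_kerP/memv_pick.
pose x t := \sum_i (v 0 i).[t] *: e`_i.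
have x_ker t : x t \in kirillov_ker (phi0 + t *: delta)%R.
  apply/kirillov_kerP => y.
  apply: (perp_span (e := e)) => [j|]; last by rewrite span_e memvf.
  have := congr1 (map_mx (horner_eval t)) vM; rewrite map_mxM pencil_gramE.
  move/rowP/(_ j); rewrite gram_mulmx !mxE /horner_eval horner0 => <-.
  by congr (_ (lie _ _)); apply: eq_bigr => i _; rewrite mxE.
have [|D D0 Dreg] := @regular_pencil phi0 delta 1.
  by rewrite scale1r addrC subrK ker1.
have Qx i t : Q i (x t) (x t) = 0.
  pose P := \sum_a \sum_b (v 0 a * v 0 b) * (Q i e`_a e`_b)%:P.
  have PE s : P.[s] = Q i (x s) (x s).
    have Ql0 z : Q i 0 z = 0.
      by apply: (addrI (Q i 0 z)); rewrite -{1}[Q i 0 z]mul1r -Ql scale1r !addr0.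
    have Qr0 z : Q i z 0 = 0.
      by apply: (addrI (Q i z 0)); rewrite -{1}[Q i z 0]mul1r -Qr scale1r !addr0.
    rewrite /P horner_sum {1}/x.
    elim/big_rec2: _ => [|a y1 y2 _ ->]; first by rewrite Ql0.
    rewrite Ql; congr (_ + _); rewrite horner_sum /x.
    elim/big_rec2: _ => [|b z1 z2 _ ->]; first by rewrite Qr0 mulr0.
    by rewrite Qr !hornerE; ring.
  suff P0 : P = 0 by rewrite -PE P0 horner0.
  have DP0 : D * P = 0.
    apply/eqP/negPn/negP => /poly_nonroot[s]; rewrite hornerM mulf_eq0 negb_or.
    case/andP=> /Dreg reg_s; rewrite PE => /eqP; apply.
    by apply: (Q0 _ _ _ (x_ker s)); apply/eqP; rewrite eqn_leq reg_s ker_gt0.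
  by move/eqP: DP0; rewrite mulf_eq0 (negPf D0) => /eqP.
exists (x 0); last by split=> //; have := x_ker 0; rewrite scale0r addr0.
apply: contra_neq v0 => x0; apply/rowP => i; rewrite !mxE.
exact: (elimT freeP free_e _ x0).
Qed.

End Kernels.

(** * Reduced stabilizers in seaweed patterns *)

Section ReducedStabilizers.
Variable K : numFieldType.
Implicit Types (lo hi : nat) (S : rel nat) (F x : nat -> nat -> K).

Lemma sum_nat_eq0 lo hi (G : nat -> K) :
  (forall l, (lo <= l < hi)%N -> G l = 0) -> \sum_(lo <= l < hi) G l = 0.
Proof. by move=> G0; rewrite big_nat big1. Qed.

Lemma sum_nat_only k lo hi (G : nat -> K) : (lo <= k < hi)%N ->
    (forall l, (lo <= l < hi)%N -> l != k -> G l = 0) ->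
  \sum_(lo <= l < hi) G l = G k.
Proof.
move=> k_in G0; have [lek ltk] := andP k_in.
rewrite (big_cat_nat (n := k)) ?(ltnW ltk) //= sum_nat_eq0 ?add0r.
  rewrite big_ltn // sum_nat_eq0 ?addr0 // => l l_in.
  by apply: G0; lia.
by move=> l l_in; apply: G0; lia.
Qed.

Lemma sum_nat_cut p lo hi (G : nat -> K) : (lo <= p <= hi)%N ->
  \sum_(lo <= l < hi) G l = \sum_(lo <= l < p) G l + \sum_(p <= l < hi) G l.
Proof. by case/andP=> lop phi; rewrite (big_cat_nat (n := p)). Qed.

Definition supported lo hi S x := forall i j,
  (lo <= i < hi)%N -> (lo <= j < hi)%N -> ~~ S i j -> x i j = 0.

(** This says that (x F - F x) j i = 0 whenever S i j, i.e. that the trace pairing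
    of F with the commutator of x and y vanishes for all y supported on S.
    Matrices are functions on nat and the index range is an interval, so that
    passing to a smaller interval involves no cast. *)
Definition stabilizes lo hi S F x := forall i j,
  (lo <= i < hi)%N -> (lo <= j < hi)%N -> S i j ->
  \sum_(lo <= l < hi) x j l * F l i = \sum_(lo <= l < hi) F j l * x l i.

Definition square_zero lo hi x := forall i j,
  (lo <= i < hi)%N -> (lo <= j < hi)%N -> \sum_(lo <= l < hi) x i l * x l j = 0.

(** The stabilizer of F is an associative algebra, so it has no nonzero nilpotent
    as soon as it has no nonzero element of square zero. *)
Definition has_reduced_stabilizer lo hi S := exists F, forall x,
  supported lo hi S x -> stabilizes lo hi S F x -> square_zero lo hi x ->
  forall i j, (lo <= i < hi)%N -> (lo <= j < hi)%N -> x i j = 0.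

(** The interval is cut as alpha = [o, p[, beta = [p, o + d[,
    gamma = [o + d, p + d[ and rho = [p + d, hi[. In F, the shift i |-> i + d
    from alpha to gamma is added to F'. The equations at column indices in
    alpha say that x on gamma copies x on alpha and that x on beta x gamma
    vanishes. So the restriction x' of x to [p, hi[, which is multiplicative
    since x maps no alpha coordinate out of alpha, lies in the smaller pattern.
    It determines x: the block on alpha x gamma is zero, and the block on
    alpha x beta is read off the commutator of x' and F'. *)
Lemma reduction_restrict o p d hi S S' :
    (o <= p)%N -> (p <= o + d)%N -> (p + d <= hi)%N ->
    (forall i j, (p <= i < hi)%N -> (o <= j < p)%N -> ~~ S i j) ->
    (forall i j, (o <= i < p + d)%N -> (p + d <= j < hi)%N -> ~~ S i j) ->
    (forall i j, (o <= i < p)%N -> (o <= j < p + d)%N -> S i j) ->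
    (forall i j, (p <= i < o + d)%N -> (o + d <= j < p + d)%N -> S i j) ->
    (forall i j, (p <= i < hi)%N -> (p <= j < hi)%N ->
      S' i j = S i j && ~~ ((p <= i < o + d) && (o + d <= j < p + d))%N) ->
  has_reduced_stabilizer p hi S' -> has_reduced_stabilizer o hi S.
Proof.
move=> op pq rhi S_pa S_rho S_a S_bg S'E [F' redF'].
pose F l i : K := if (i < p)%N then (l == i + d)%N%:R
                  else if (p <= l)%N then F' l i else 0.
exists F => x suppx stabx sqx.
have x_pa i j : (p <= i < hi)%N -> (o <= j < p)%N -> x i j = 0.
  by move=> i_in j_in; apply: suppx; last apply: S_pa; lia.
have x_rho i j : (o <= i < p + d)%N -> (p + d <= j < hi)%N -> x i j = 0.
  by move=> i_in j_in; apply: suppx; last apply: S_rho; lia.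
have to_gamma j : (o + d <= j < p + d)%N -> exists2 k, (o <= k < p)%N & j = (k + d)%N.
  by move=> j_in; exists (j - d)%N; lia.
have xF_a i j : (o <= i < p)%N ->
    \sum_(o <= l < hi) x j l * F l i = x j (i + d)%N.
  move=> i_in; have i_p : (i < p)%N by lia.
  rewrite (sum_nat_only (k := (i + d)%N)) /F ?i_p ?eqxx ?mulr1 //; first by lia.
  by move=> l _ /negPf->; rewrite mulr0.
have xF_p i j : (p <= i < hi)%N ->
    \sum_(o <= l < hi) x j l * F l i = \sum_(p <= l < hi) x j l * F' l i.
  move=> i_in; have i_p : (i < p)%N = false by lia.
  rewrite (sum_nat_cut (p := p)); last by lia.
  rewrite sum_nat_eq0 ?add0r => [|l l_in].
    by apply: eq_big_nat => l /andP[p_l _]; rewrite /F i_p p_l.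
  by rewrite /F i_p leqNgt; case/andP: l_in => _ ->; rewrite mulr0.
have Fx_a i j : (o <= j < p)%N -> \sum_(o <= l < hi) F j l * x l i = 0.
  move=> j_in; apply: sum_nat_eq0 => l l_in; rewrite /F.
  have -> : (p <= j)%N = false by lia.
  have -> : (j == l + d)%N = false by lia.
  by case: ifP; rewrite mul0r.
have Fx_p i j : (p <= j < hi)%N ->
    \sum_(o <= l < hi) F j l * x l i =
    \sum_(o <= l < p) (j == l + d)%N%:R * x l i +
    \sum_(p <= l < hi) F' j l * x l i.
  move=> /andP[p_j j_hi]; rewrite (sum_nat_cut (p := p)); last by lia.
  congr (_ + _); apply: eq_big_nat => l /andP[l1 l2]; rewrite /F.
    by rewrite l2.
  by rewrite ltnNge l1 p_j.
have Fx_g i k : (o <= k < p)%N ->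
    \sum_(o <= l < p) (k + d == l + d)%N%:R * x l i = x k i.
  move=> k_in; rewrite (sum_nat_only (k := k)) ?eqxx ?mul1r // => l _ l_neq.
  by rewrite eqn_add2r eq_sym (negPf l_neq) mul0r.
have Fx_ng i j : ~~ (o + d <= j < p + d)%N ->
    \sum_(o <= l < p) (j == l + d)%N%:R * x l i = 0.
  move=> j_n; apply: sum_nat_eq0 => l l_in.
  by rewrite (_ : j == _ = false) ?mul0r //; lia.
have F'x_a i j : (o <= i < p)%N -> \sum_(p <= l < hi) F' j l * x l i = 0.
  by move=> i_in; apply: sum_nat_eq0 => l l_in; rewrite x_pa ?mulr0.
have stab_a i j : (o <= i < p)%N -> (o <= j < p + d)%N ->
    x j (i + d)%N = \sum_(o <= l < hi) F j l * x l i.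
  by move=> i_in j_in; rewrite -xF_a // stabx ?S_a //; lia.
have x_bg i k : (p <= i < o + d)%N -> (o <= k < p)%N -> x i (k + d)%N = 0.
  move=> i_in k_in; rewrite stab_a ?Fx_p ?F'x_a ?addr0 ?Fx_ng //; lia.
have x_gg i k : (o <= i < p)%N -> (o <= k < p)%N -> x (i + d)%N (k + d)%N = x i k.
  by move=> i_in k_in; rewrite stab_a ?Fx_p ?F'x_a ?addr0 ?Fx_g //; lia.
have x_ag i k : (o <= i < p)%N -> (o <= k < p)%N -> x i (k + d)%N = 0.
  by move=> i_in k_in; rewrite stab_a ?Fx_a //; lia.
have x'0 : forall i j, (p <= i < hi)%N -> (p <= j < hi)%N -> x i j = 0.
  apply: redF'.
  - move=> i j i_in j_in; rewrite S'E // negb_and negbK => /orP[nSij|/andP[i_b]].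
      by apply: suppx => //; lia.
    by move=> /to_gamma[k k_in ->]; apply: x_bg.
  - move=> i j i_in j_in; rewrite S'E // => /andP[Sij ij_in].
    rewrite -xF_p // stabx ?Fx_p //; try lia.
    have [j_g|j_ng] := boolP (o + d <= j < p + d)%N; last first.
      by rewrite Fx_ng // add0r.
    have i_ge : (o + d <= i)%N by lia.
    have [k k_in ->] := to_gamma j j_g; rewrite Fx_g //.
    have [i_rho|i_g] := leqP (p + d) i.
      by rewrite x_rho ?add0r //; lia.
    have /to_gamma[m m_in ->] : (o + d <= i < p + d)%N by rewrite i_ge.
    by rewrite x_ag ?add0r.
  - move=> i j i_in j_in; rewrite -[RHS](sqx i j); try lia.
    rewrite [RHS](sum_nat_cut (p := p)); last by lia.
    by rewrite [X in _ = X + _]sum_nat_eq0 ?add0r // => l l_in; rewrite x_pa ?mul0r.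
move=> i j i_in j_in.
have [p_i|i_p] := leqP p i.
  have [p_j|j_p] := leqP p j; first by apply: x'0; lia.
  by apply: x_pa; lia.
have [r_j|j_r] := leqP (p + d) j; first by apply: x_rho; lia.
have [q_j|j_q] := leqP (o + d) j.
  have /to_gamma[k k_in ->] : (o + d <= j < p + d)%N by rewrite q_j.
  by apply: x_ag => //; lia.
have [p_j|j_p] := leqP p j; last first.
  by rewrite -x_gg ?x'0 //; lia.
(* alpha x beta: the equation at (j, i + d) expresses x i j by entries of x'. *)
have := stabx j (i + d)%N; rewrite xF_p ?Fx_p ?Fx_g; try lia.
rewrite ![\sum_(_ <= _ < _) _]sum_nat_eq0 ?addr0.
- by move=> <- //; try lia; apply: S_bg; lia.
- by move=> l l_in; rewrite x'0 ?mulr0 //; lia.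
- by move=> l l_in; rewrite x'0 ?mul0r //; lia.
Qed.

Lemma sum_nat_shift d lo hi (G : nat -> K) :
  \sum_(lo + d <= l < hi + d) G l = \sum_(lo <= l < hi) G (l + d)%N.
Proof. by rewrite big_addn addnK. Qed.

(** With the intervals named as above, the pattern contains all positions of
    alpha + beta, where the previous restriction would not be multiplicative.
    The equations for F give x = 0 on alpha x beta and identify x on gamma with
    x on alpha. Hence the blocks of x on alpha + beta can be glued to those on
    gamma + rho along alpha = gamma: x' has on beta x gamma the block that x
    has on beta x alpha. For the same reason the rows of F' in gamma that meet
    beta become rows of F in alpha. *)
Lemma reduction_reglue o p d hi S S' :
    (o <= p)%N -> (p <= o + d)%N -> (p + d <= hi)%N ->
    (forall i j, (o + d <= i < hi)%N -> (o <= j < o + d)%N -> ~~ S i j) ->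
    (forall i j, (o <= i < p + d)%N -> (p + d <= j < hi)%N -> ~~ S i j) ->
    (forall i j, (o <= i < o + d)%N -> (o <= j < p + d)%N -> S i j) ->
    (forall i j, (p <= i < hi)%N -> (p <= j < hi)%N ->
      S' i j = if (i < o + d)%N then (j < p + d)%N
               else (o + d <= j)%N && S i j) ->
  has_reduced_stabilizer p hi S' -> has_reduced_stabilizer o hi S.
Proof.
move=> op pq rhi S_low S_rho S_up S'E [F' redF'].
have p_r : (p <= p + d)%N by lia.
have q_r : (o + d <= p + d)%N by lia.
pose F l i : K :=
  if (l < o + d)%N then
    if (p <= i < o + d)%N then F' (if (l < p)%N then l + d else l)%N i else 0
  else if (i < p)%N then (l == i + d)%N%:R
  else if (o + d <= i)%N then F' l i else 0.
exists F => x suppx stabx sqx.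
have x_low i j : (o + d <= i < hi)%N -> (o <= j < o + d)%N -> x i j = 0.
  by move=> i_in j_in; apply: suppx; last apply: S_low; lia.
have x_rho i j : (o <= i < p + d)%N -> (p + d <= j < hi)%N -> x i j = 0.
  by move=> i_in j_in; apply: suppx; last apply: S_rho; lia.
have to_gamma j : (o + d <= j < p + d)%N -> exists2 k, (o <= k < p)%N & j = (k + d)%N.
  by move=> j_in; exists (j - d)%N; lia.
have xF_a i j : (o <= i < p)%N ->
    \sum_(o <= l < hi) x j l * F l i = x j (i + d)%N.
  move=> i_in; have i_p : (i < p)%N by lia.
  have i_nb : (p <= i < o + d)%N = false by lia.
  have q_i : (i + d < o + d)%N = false by lia.
  rewrite (sum_nat_only (k := (i + d)%N)) /F ?i_p ?q_i ?eqxx ?mulr1 //; first by lia.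
  by move=> l _ /negPf->; rewrite i_nb; case: ifP; rewrite mulr0.
have xF_b i j : (p <= i < o + d)%N -> \sum_(o <= l < hi) x j l * F l i =
    \sum_(o <= l < p) x j l * F' (l + d)%N i + \sum_(p <= l < o + d) x j l * F' l i.
  move=> i_b; have i_p : (i < p)%N = false by lia.
  have i_q : (o + d <= i)%N = false by lia.
  rewrite (sum_nat_cut (p := p)); last by lia.
  rewrite [X in _ + X](sum_nat_cut (p := (o + d)%N)); last by lia.
  rewrite [X in _ + (_ + X)]sum_nat_eq0 ?addr0 => [|l /andP[l_q _]].
    congr (_ + _); apply: eq_big_nat => l /andP[l1 l2]; rewrite /F i_b.
      by rewrite l2 (leq_trans l2 pq).
    by rewrite l2 ltnNge l1.
  by rewrite /F ltnNge l_q /= i_p i_q mulr0.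
have xF_q i j : (o + d <= i < hi)%N ->
    \sum_(o <= l < hi) x j l * F l i = \sum_(o + d <= l < hi) x j l * F' l i.
  move=> i_in; have i_p : (i < p)%N = false by lia.
  have i_q : (o + d <= i)%N by lia.
  have i_nb : (p <= i < o + d)%N = false by lia.
  rewrite (sum_nat_cut (p := (o + d)%N)); last by lia.
  rewrite sum_nat_eq0 ?add0r => [|l /andP[_ l_q]].
    by apply: eq_big_nat => l /andP[l_q _]; rewrite /F ltnNge l_q i_p i_q.
  by rewrite /F l_q i_nb mulr0.
have Fx_ab i j : (o <= j < o + d)%N -> \sum_(o <= l < hi) F j l * x l i =
    \sum_(p <= l < o + d) F' (if (j < p)%N then j + d else j)%N l * x l i.
  move=> /andP[_ j_q]; rewrite (sum_nat_cut (p := p)); last by lia.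
  rewrite [X in _ + X](sum_nat_cut (p := (o + d)%N)); last by lia.
  rewrite sum_nat_eq0 ?add0r => [|l l_in]; last first.
    by rewrite /F j_q (_ : (p <= l < _)%N = false) ?mul0r //; lia.
  rewrite [X in _ + X]sum_nat_eq0 ?addr0 => [|l l_in]; last first.
    by rewrite /F j_q (_ : (p <= l < _)%N = false) ?mul0r //; lia.
  by apply: eq_big_nat => l l_in; rewrite /F j_q l_in.
have Fx_q i j : (o + d <= j < hi)%N -> \sum_(o <= l < hi) F j l * x l i =
    \sum_(o <= l < p) (j == l + d)%N%:R * x l i +
    \sum_(o + d <= l < hi) F' j l * x l i.
  move=> /andP[q_j _]; have j_q : (j < o + d)%N = false by lia.
  rewrite (sum_nat_cut (p := p)); last by lia.
  rewrite [X in _ + X](sum_nat_cut (p := (o + d)%N)); last by lia.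
  rewrite [X in _ + (X + _)]sum_nat_eq0 ?add0r => [|l l_in]; last first.
    rewrite /F j_q (_ : (l < p)%N = false); last by lia.
    by rewrite (_ : (o + d <= l)%N = false) ?mul0r //; lia.
  congr (_ + _); apply: eq_big_nat => l l_in; rewrite /F j_q.
    by rewrite (_ : (l < p)%N) //; lia.
  rewrite (_ : (l < p)%N = false); last by lia.
  by rewrite (_ : (o + d <= l)%N) //; lia.
have Fx_g i k : (o <= k < p)%N ->
    \sum_(o <= l < p) (k + d == l + d)%N%:R * x l i = x k i.
  move=> k_in; rewrite (sum_nat_only (k := k)) ?eqxx ?mul1r // => l _ l_neq.
  by rewrite eqn_add2r eq_sym (negPf l_neq) mul0r.
have F'x_ab i j : (o <= i < o + d)%N -> \sum_(o + d <= l < hi) F' j l * x l i = 0.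
  by move=> i_in; apply: sum_nat_eq0 => l l_in; rewrite x_low ?mulr0.
have x_gg i k : (o <= i < p)%N -> (o <= k < p)%N -> x (k + d)%N (i + d)%N = x k i.
  move=> i_in k_in; have := stabx i (k + d)%N.
  rewrite xF_a // Fx_q ?F'x_ab ?Fx_g ?addr0; try lia.
  by apply; try lia; apply: S_up; lia.
have x_ab k i : (o <= k < p)%N -> (p <= i < o + d)%N -> x k i = 0.
  move=> k_in i_in; have := stabx i (k + d)%N.
  rewrite xF_b // Fx_q ?F'x_ab ?Fx_g ?addr0; try lia.
  rewrite ![\sum_(_ <= _ < _) _]sum_nat_eq0 ?addr0.
  - by move=> <- //; try lia; apply: S_up; lia.
  - by move=> l l_in; rewrite x_low ?mul0r //; lia.
  - by move=> l l_in; rewrite x_low ?mul0r //; lia.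
have x_abg j i : (o <= j < o + d)%N -> (o <= i < p)%N -> x j (i + d)%N =
    \sum_(p <= l < o + d) F' (if (j < p)%N then j + d else j)%N l * x l i.
  by move=> j_in i_in; rewrite -xF_a // stabx ?Fx_ab //; try lia; apply: S_up; lia.
have x_b j i : (o <= j < o + d)%N -> (p <= i < o + d)%N ->
    \sum_(o <= l < p) x j l * F' (l + d)%N i + \sum_(p <= l < o + d) x j l * F' l i =
    \sum_(p <= l < o + d) F' (if (j < p)%N then j + d else j)%N l * x l i.
  by move=> j_in i_in; rewrite -xF_b // stabx ?Fx_ab //; try lia; apply: S_up; lia.
(* The column index l of gamma stands for l - d of alpha in the rows beta. *)
pose x' k l := if (k < o + d)%N then
    if (l < o + d)%N then x k l else if (l < p + d)%N then x k (l - d)%N else 0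
  else if (l < o + d)%N then 0 else x k l.
have x'_bb k l : (p <= k < o + d)%N -> (p <= l < o + d)%N -> x' k l = x k l.
  by rewrite /x' => /andP[_ ->] /andP[_ ->].
have x'_bg k l : (p <= k < o + d)%N -> (o <= l < p)%N -> x' k (l + d)%N = x k l.
  move=> /andP[_ k_q] /andP[o_l l_p]; rewrite /x' addnK k_q ltnNge.
  by rewrite !leq_add2r o_l ltn_add2r l_p.
have x'_brho k l : (p <= k < o + d)%N -> (p + d <= l < hi)%N -> x' k l = 0.
  move=> /andP[_ k_q] /andP[r_l _]; rewrite /x' k_q !ltnNge r_l.
  by rewrite (leq_trans q_r r_l).
have x'_low k l : (o + d <= k < hi)%N -> (p <= l < o + d)%N -> x' k l = 0.
  by move=> /andP[q_k _] /andP[_ l_q]; rewrite /x' ltnNge q_k /= l_q.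
have x'_q k l : (o + d <= k < hi)%N -> (o + d <= l < hi)%N -> x' k l = x k l.
  by move=> /andP[q_k _] /andP[q_l _]; rewrite /x' !ltnNge q_k q_l.
have x'0 : forall i j, (p <= i < hi)%N -> (p <= j < hi)%N -> x' i j = 0.
  apply: redF'.
  - move=> i j i_in j_in; rewrite S'E //; case: ifP => [i_q j_r|i_q].
      by apply: x'_brho; lia.
    rewrite negb_and => /orP[j_q|nSij]; first by apply: x'_low; lia.
    have [q_j|j_q] := leqP (o + d) j; last by apply: x'_low; lia.
    by rewrite x'_q; [apply: suppx => //; lia|lia|lia].
  - move=> i j i_in j_in; rewrite S'E //.
    rewrite [LHS](sum_nat_cut (p := (o + d)%N)); last by lia.
    rewrite [RHS](sum_nat_cut (p := (o + d)%N)); last by lia.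
    case: ifP => [i_q j_r|i_q /andP[q_j Sij]].
      have i_b : (p <= i < o + d)%N by lia.
      rewrite [X in _ = _ + X]sum_nat_eq0 ?addr0 => [|l l_in]; last first.
        by rewrite x'_low ?mulr0.
      rewrite [X in _ + X = _](sum_nat_cut (p := (p + d)%N)); last by lia.
      rewrite [X in _ + (_ + X) = _]sum_nat_eq0 ?addr0 => [|l l_in]; last first.
        have [q_j|j_q] := leqP (o + d) j; last by rewrite x'_brho ?mul0r //; lia.
        by rewrite x'_q ?x_rho ?mul0r //; lia.
      rewrite sum_nat_shift.
      have [q_j|j_q] := leqP (o + d) j.
        have [k k_in jE] : exists2 k, (o <= k < p)%N & j = (k + d)%N.
          by apply: to_gamma; lia.
        rewrite [X in X + _ = _]sum_nat_eq0 ?add0r => [|l l_in]; last first.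
          by rewrite x'_low ?mul0r //; lia.
        have := x_b k i; rewrite [X in _ + X = _]sum_nat_eq0; last first.
          by move=> l l_in; rewrite x_ab ?mul0r.
        rewrite addr0 (_ : (k < p)%N); last by lia.
        rewrite -jE => kE.
        rewrite [RHS](eq_big_nat _ _ (F2 := fun l => F' j l * x l i)) => [|l l_in]; last first.
          by rewrite x'_bb.
        rewrite -kE; [|lia|lia]; apply: eq_big_nat => l l_in.
        by rewrite jE x'_q ?x_gg //; lia.
      rewrite [RHS](eq_big_nat _ _ (F2 := fun l => F' j l * x l i)) => [|l l_in]; last first.
        by rewrite x'_bb.
      have := x_b j i; rewrite (_ : (j < p)%N = false); last by lia.
      move=> <- //; last by lia.
      rewrite addrC; congr (_ + _); apply: eq_big_nat => l l_in.
        by rewrite x'_bg //; lia.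
      by rewrite x'_bb //; lia.
    rewrite [X in X + _ = _]sum_nat_eq0 ?add0r => [|l l_in]; last first.
      by rewrite x'_low ?mul0r //; lia.
    rewrite (eq_big_nat _ _ (F2 := fun l => x j l * F' l i)) => [|l l_in]; last first.
      by rewrite x'_q //; lia.
    rewrite [X in _ = _ + X](eq_big_nat _ _ (F2 := fun l => F' j l * x l i)); last first.
      by move=> l l_in; rewrite x'_q //; lia.
    (* The sum over alpha coming from the shift in F turns into the sum over beta
       in the product of F' and x', by the equation for x on alpha x gamma. *)
    rewrite -xF_q; last by lia.
    rewrite stabx //; [rewrite Fx_q; last by lia|lia|lia].
    congr (_ + _).
    have [r_i|i_r] := leqP (p + d) i.
      rewrite ![\sum_(_ <= _ < _) _]sum_nat_eq0 // => l l_in.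
        by rewrite x'_brho ?mulr0 //; lia.
      by rewrite x_rho ?mulr0 //; lia.
    have [m m_in iE] : exists2 m, (o <= m < p)%N & i = (m + d)%N.
      by apply: to_gamma; lia.
    have [r_j|j_r] := leqP (p + d) j.
      by have := S_rho i j; rewrite Sij => /(_ _ _)/implyP; lia.
    have [k k_in jE] : exists2 k, (o <= k < p)%N & j = (k + d)%N.
      by apply: to_gamma; lia.
    rewrite iE jE Fx_g // x_abg //; last by lia.
    rewrite (_ : (k < p)%N); last by lia.
    by apply: eq_big_nat => l l_in; rewrite x'_bg.
  - move=> i j i_in j_in.
    rewrite (sum_nat_cut (p := (o + d)%N)); last by lia.
    have [q_i|i_q] := leqP (o + d) i.
      rewrite [X in X + _]sum_nat_eq0 ?add0r => [|l l_in]; last first.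
        by rewrite x'_low ?mul0r //; lia.
      have [q_j|j_q] := leqP (o + d) j; last first.
        by apply: sum_nat_eq0 => l l_in; rewrite [x' l j]x'_low ?mulr0 //; lia.
      rewrite -[RHS](sqx i j); try lia.
      rewrite [RHS](sum_nat_cut (p := (o + d)%N)); last by lia.
      rewrite [X in _ = X + _]sum_nat_eq0 ?add0r => [|l l_in]; last first.
        by rewrite x_low ?mul0r //; lia.
      by apply: eq_big_nat => l l_in; rewrite !x'_q //; lia.
    have [q_j|j_q] := leqP (o + d) j; last first.
      rewrite [X in _ + X]sum_nat_eq0 ?addr0 => [|l l_in]; last first.
        by rewrite [x' l j]x'_low ?mulr0 //; lia.
      rewrite -[RHS](sqx i j); try lia.
      rewrite [RHS](sum_nat_cut (p := p)); last by lia.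
      rewrite [X in _ = X + _]sum_nat_eq0 ?add0r => [|l l_in]; last first.
        by rewrite [x l j]x_ab ?mulr0 //; lia.
      rewrite [RHS](sum_nat_cut (p := (o + d)%N)); last by lia.
      rewrite [X in _ = _ + X]sum_nat_eq0 ?addr0 => [|l l_in]; last first.
        by rewrite [x l j]x_low ?mulr0 //; lia.
      by apply: eq_big_nat => l l_in; rewrite !x'_bb //; lia.
    rewrite [X in _ + X](sum_nat_cut (p := (p + d)%N)); last by lia.
    rewrite [X in _ + (_ + X)]sum_nat_eq0 ?addr0 => [|l l_in]; last first.
      by rewrite x'_brho ?mul0r //; lia.
    have [r_j|j_r] := leqP (p + d) j.
      rewrite ![\sum_(_ <= _ < _) _]sum_nat_eq0 ?addr0 // => l l_in.
        by rewrite [x' l j]x'_q ?x_rho ?mulr0 //; lia.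
      by rewrite [x' l j]x'_brho ?mulr0 //; lia.
    have [m m_in jE] : exists2 m, (o <= m < p)%N & j = (m + d)%N.
      by apply: to_gamma; lia.
    rewrite -[RHS](sqx i m); try lia.
    rewrite [RHS](sum_nat_cut (p := p)); last by lia.
    rewrite [X in _ = _ + X](sum_nat_cut (p := (o + d)%N)); last by lia.
    rewrite [X in _ = _ + (_ + X)]sum_nat_eq0 ?addr0 => [|l l_in]; last first.
      by rewrite [x l m]x_low ?mulr0 //; lia.
    rewrite sum_nat_shift addrC jE; congr (_ + _); apply: eq_big_nat => l l_in.
      by rewrite x'_bg ?x'_q ?x_gg //; lia.
    by rewrite x'_bb ?x'_bg //; lia.
have x_qq i j : (o + d <= i < hi)%N -> (o + d <= j < hi)%N -> x i j = 0.
  by move=> i_in j_in; rewrite -x'_q ?x'0 //; lia.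
have x_ba i j : (p <= i < o + d)%N -> (o <= j < p)%N -> x i j = 0.
  by move=> i_in j_in; rewrite -x'_bg ?x'0 //; lia.
have x_bb i j : (p <= i < o + d)%N -> (p <= j < o + d)%N -> x i j = 0.
  by move=> i_in j_in; rewrite -x'_bb ?x'0 //; lia.
move=> i j i_in j_in.
have [q_i|i_q] := leqP (o + d) i.
  have [q_j|j_q] := leqP (o + d) j; first by apply: x_qq; lia.
  by apply: x_low; lia.
have [q_j|j_q] := leqP (o + d) j.
  have [r_j|j_r] := leqP (p + d) j; first by apply: x_rho; lia.
  have [m m_in ->] : exists2 m, (o <= m < p)%N & j = (m + d)%N.
    by apply: to_gamma; lia.
  by rewrite x_abg ?sum_nat_eq0 // => [l l_in|]; [rewrite x_ba ?mulr0|lia].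
have [p_i|i_p] := leqP p i; have [p_j|j_p] := leqP p j.
- by apply: x_bb; lia.
- by apply: x_ba; lia.
- by apply: x_ab; lia.
- by rewrite -x_gg ?x_qq //; lia.
Qed.

(** A full matrix block with no link to the rest splits off. Distinct diagonal
    entries of F, here the indices themselves, force x to be diagonal on it. *)
Lemma reduction_component o p hi S : (o <= p <= hi)%N ->
    (forall i j, (o <= i < p)%N -> (p <= j < hi)%N -> ~~ S i j) ->
    (forall i j, (p <= i < hi)%N -> (o <= j < p)%N -> ~~ S i j) ->
    (forall i j, (o <= i < p)%N -> (o <= j < p)%N -> S i j) ->
  has_reduced_stabilizer p hi S -> has_reduced_stabilizer o hi S.
Proof.
move=> oph S_ar S_ra S_a [F' redF'].
pose F l i : K := if (p <= l)%N && (p <= i)%N then F' l i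
                  else if l == i then l%:R else 0.
exists F => x suppx stabx sqx.
have x_ar i j : (o <= i < p)%N -> (p <= j < hi)%N -> x i j = 0.
  by move=> i_in j_in; apply: suppx; last apply: S_ar; lia.
have x_ra i j : (p <= i < hi)%N -> (o <= j < p)%N -> x i j = 0.
  by move=> i_in j_in; apply: suppx; last apply: S_ra; lia.
have x'0 : forall i j, (p <= i < hi)%N -> (p <= j < hi)%N -> x i j = 0.
  apply: redF'.
  - by move=> i j i_in j_in; apply: suppx; lia.
  - move=> i j i_in j_in Sij; have := stabx i j.
    rewrite [X in _ -> _ -> _ -> X = _](sum_nat_cut (p := p)); last by lia.
    rewrite [X in _ -> _ -> _ -> _ = X](sum_nat_cut (p := p)); last by lia.
    rewrite [X in _ -> _ -> _ -> X + _ = _]sum_nat_eq0 ?add0r => [|l l_in]; last first.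
      by rewrite x_ra ?mul0r //; lia.
    rewrite [X in _ -> _ -> _ -> _ = X + _]sum_nat_eq0 ?add0r => [|l l_in]; last first.
      by rewrite x_ar ?mulr0 //; lia.
    move=> E; rewrite (eq_big_nat _ _ (F2 := fun l => x j l * F l i)).
      rewrite E //; try lia; apply: eq_big_nat => l /andP[l_p _].
      by rewrite /F l_p; case/andP: j_in => ->.
    by move=> l /andP[l_p _]; rewrite /F l_p; case/andP: i_in => ->.
  - move=> i j i_in j_in; rewrite -[RHS](sqx i j); try lia.
    rewrite [RHS](sum_nat_cut (p := p)); last by lia.
    by rewrite [X in _ = X + _]sum_nat_eq0 ?add0r // => l l_in; rewrite x_ra ?mul0r.
have x_neq i j : (o <= i < p)%N -> (o <= j < p)%N -> i != j -> x i j = 0.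
  move=> i_in j_in ij; have := stabx j i.
  have p_i : (p <= i)%N = false by lia.
  have p_j : (p <= j)%N = false by lia.
  rewrite (sum_nat_only (k := j)); [|lia|move=> l _ /negPf lj]; last first.
    by rewrite /F lj p_j andbF mulr0.
  rewrite (sum_nat_only (k := i)); [|lia|move=> l _ li]; last first.
    by rewrite /F eq_sym (negPf li) p_i mul0r.
  rewrite /F !eqxx p_i p_j mulrC => E.
  have /eqP : (j%:R - i%:R) * x i j = 0.
    by rewrite mulrBl E ?subrr //; try lia; apply: S_a; lia.
  by rewrite mulf_eq0 subr_eq0 eqr_nat eq_sym (negPf ij) => /eqP.
move=> i j i_in j_in.
have [p_i|i_p] := leqP p i; have [p_j|j_p] := leqP p j.
- by apply: x'0; lia.
- by apply: x_ra; lia.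
- by apply: x_ar; lia.
have [<-|] := eqVneq i j; last by apply: x_neq; lia.
have := sqx i i; rewrite (sum_nat_only (k := i)) //; last first.
  move=> l l_in l_neq; have [p_l|l_p] := leqP p l.
    by rewrite x_ar ?mul0r //; lia.
  by rewrite x_neq ?mul0r // ?[i == l]eq_sym //; lia.
by move=> /(_ _ _)/eqP; rewrite mulf_eq0 orbb => E; apply/eqP/E.
Qed.

Lemma reduced_stabilizer_tr lo hi S :
  has_reduced_stabilizer lo hi (fun i j => S j i) -> has_reduced_stabilizer lo hi S.
Proof.
case=> F redF; exists (fun i j => F j i) => x suppx stabx sqx i j i_in j_in.
apply: (redF (fun i j => x j i)) => // {i j i_in j_in} i j i_in j_in.
- exact: suppx.
- move=> Sij; have := stabx j i j_in i_in Sij => E.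
  under eq_bigr do rewrite mulrC; rewrite -E.
  by apply: eq_bigr => l _; rewrite mulrC.
- by rewrite -[RHS](sqx j i) //; apply: eq_bigr => l _; rewrite mulrC.
Qed.

Lemma eq_reduced_stabilizer lo hi S S' :
    (forall i j, (lo <= i < hi)%N -> (lo <= j < hi)%N -> S i j = S' i j) ->
  has_reduced_stabilizer lo hi S -> has_reduced_stabilizer lo hi S'.
Proof.
move=> eqS [F redF]; exists F => x suppx stabx; apply: redF => i j i_in j_in.
  by rewrite eqS //; apply: suppx.
by rewrite eqS //; apply: stabx.
Qed.

(** Blocks are counted from position lo, so that peeling off the first block of
    a composition keeps the positions. Empty blocks are allowed, because the
    induction below creates one when a block is exactly halved. *)
Fixpoint in_block lo (a : seq nat) (i j : nat) : bool :=
  if a is m :: a' then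
    (lo <= i < lo + m)%N && (lo <= j < lo + m)%N || in_block (lo + m) a' i j
  else false.

Lemma in_block_range lo a i j : in_block lo a i j ->
  (lo <= i < lo + sumn a)%N && (lo <= j < lo + sumn a)%N.
Proof. by elim: a lo => //= m a IHa lo /orP[|/IHa]; lia. Qed.

Lemma in_block_sym lo a : symmetric (in_block lo a).
Proof. by move=> i j; elim: a lo => //= m a IHa lo; rewrite IHa andbC. Qed.

Lemma reshape_index_cons m a i :
  reshape_index (m :: a) i = if (i < m)%N then 0%N else (reshape_index a (i - m)).+1.
Proof.
rewrite /reshape_index /= subn_eq0; case: ltnP => // le_mi.
by rewrite subSn.
Qed.

Lemma in_blockE lo a i j :
    (lo <= i < lo + sumn a)%N -> (lo <= j < lo + sumn a)%N ->
  in_block lo a i j = same_block a (i - lo) (j - lo).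
Proof.
rewrite /same_block; elim: a lo => [|m a IHa] lo /=; first by lia.
move=> i_in j_in; rewrite !reshape_index_cons !ltn_subLR; try lia.
have [i_m|m_i] := ltnP i (lo + m); have [j_m|m_j] := ltnP j (lo + m).
- by case/andP: i_in => ->; case/andP: j_in => ->; rewrite eqxx.
- by rewrite !andbF; apply/negbTE/negP => /in_block_range; lia.
- by rewrite !andbF; apply/negbTE/negP => /in_block_range; lia.
- by rewrite !andbF eqSS /= IHa ?subnDA //; lia.
Qed.

Definition seaweed_rel lo (a b : seq nat) : rel nat := fun i j =>
  ((j <= i) && in_block lo a i j || (i <= j) && in_block lo b i j)%N.

(** Induction on the sum and lengths of the compositions, exchanged if need be
    so that their first blocks satisfy m <= k. Equal blocks split off. If
    2m <= k, the block k is replaced by k - 2m and m while m is removed; if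
    m < k < 2m, the blocks m and k are replaced by 2m - k and m. These are the
    contraction moves on meander graphs. *)
Lemma seaweed_has_reduced_stabilizer lo a b : sumn a = sumn b ->
  has_reduced_stabilizer lo (lo + sumn a) (seaweed_rel lo a b).
Proof.
have [N] := ubnP (sumn a + size a + size b)%N.
elim: N lo a b => // N IHN lo [|m a] [|k b] /= ltN eq_sum;
  try by exists (fun _ _ => 0) => x _ _ _ i j; lia.
wlog le_mk : m k a b ltN eq_sum / (m <= k)%N => [IH|].
  have [|/ltnW lt_km] := leqP m k; first exact: IH.
  have := IH k m b a; rewrite -eq_sum => /(_ _ erefl lt_km) H.
  apply: reduced_stabilizer_tr; apply: eq_reduced_stabilizer (H _); last by lia.
  move=> i j _ _; rewrite /seaweed_rel orbC.
  by rewrite (in_block_sym _ (m :: a)) (in_block_sym _ (k :: b)).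
have [m0|m_gt0] := posnP m.
  have := IHN lo a (k :: b); rewrite m0 /= => H.
  apply: eq_reduced_stabilizer (H _ _); [|lia|lia] => i j i_in j_in.
  by rewrite /seaweed_rel /= addn0; lia.
have range_a := @in_block_range (lo + m) a.
have range_b := @in_block_range (lo + k) b.
have [eq_mk|neq_mk] := eqVneq m k.
  rewrite -{}eq_mk in ltN eq_sum range_b le_mk *.
  have := IHN (lo + m)%N a b; rewrite -(addnA lo) => H.
  apply: (reduction_component (p := (lo + m)%N)); first by lia.
  - move=> i j i_in j_in; rewrite /seaweed_rel /=.
    by have := range_a i j; have := range_b i j; lia.
  - move=> i j i_in j_in; rewrite /seaweed_rel /=.
    by have := range_a i j; have := range_b i j; lia.
  - by move=> i j i_in j_in; rewrite /seaweed_rel /=; lia.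
  apply: eq_reduced_stabilizer (H _ _); [|lia|lia] => i j i_in j_in.
  by rewrite /seaweed_rel /=; lia.
have [le_2mk|lt_k2m] := leqP (m + m) k.
  have eq_k : (lo + m + (k - (m + m)) + m = lo + k)%N by lia.
  have := IHN (lo + m)%N a [:: (k - (m + m))%N, m & b]; rewrite -(addnA lo m (sumn a)) => H.
  apply: (reduction_restrict (p := (lo + m)%N) (d := (k - m)%N)
           _ _ _ _ _ _ _ _ (H _ _)); rewrite /= ?eq_k; try lia.
  - move=> i j i_in j_in; rewrite /seaweed_rel /=.
    by have := range_a i j; have := range_b i j; lia.
  - move=> i j i_in j_in; rewrite /seaweed_rel /=.
    by have := range_a i j; have := range_b i j; lia.
  - by move=> i j i_in j_in; rewrite /seaweed_rel /=; lia.
  - by move=> i j i_in j_in; rewrite /seaweed_rel /=; lia.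
  - move=> i j i_in j_in; rewrite /seaweed_rel /= eq_k.
    by have := range_a i j; have := range_b i j; lia.
have eq_m : (lo + (k - m) + (m + m - k) = lo + m)%N by lia.
have eq_k : (lo + (k - m) + m = lo + k)%N by lia.
have := IHN (lo + (k - m))%N ((m + m - k)%N :: a) (m :: b).
rewrite /= (addnA (lo + (k - m))%N) eq_m -(addnA lo m (sumn a)) => H.
apply: (reduction_reglue (p := (lo + (k - m))%N) (d := m)
         _ _ _ _ _ _ _ (H _ _)); try lia.
- move=> i j i_in j_in; rewrite /seaweed_rel /=.
  by have := range_a i j; have := range_b i j; lia.
- move=> i j i_in j_in; rewrite /seaweed_rel /=.
  by have := range_a i j; have := range_b i j; lia.
- by move=> i j i_in j_in; rewrite /seaweed_rel /=; lia.
- move=> i j i_in j_in; rewrite /seaweed_rel /= eq_m eq_k.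
  by have := range_a i j; have := range_b i j; case: ifP; lia.
Qed.

End ReducedStabilizers.

(** * Squares in the kernel of a Kirillov form on a seaweed *)

Section IdempotentTrace.
Variable K : numFieldType.

(** A rank factorization A = C R of an idempotent has R C = 1. *)
Lemma mxtrace_idempotent n (A : 'M[K]_n) : A *m A = A -> \tr A = (\rank A)%:R.
Proof.
move=> AA; rewrite -{1}(mulmx_base A) mxtrace_mulC.
suff -> : row_base A *m col_base A = 1%:M by rewrite mxtrace1.
apply: (row_full_inj (col_base_full A)); apply: (row_free_inj (row_base_free A)).
by rewrite /= mulmx1 mulmxA !mulmx_base -mulmxA mulmx_base AA.
Qed.

(** If c <> 0, then c^-1 A is an idempotent of trace 0, hence of rank 0 in
    characteristic 0. *)
Lemma traceless_square_proportional n (A : 'M[K]_n) c :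
  \tr A = 0 -> A *m A = c *: A -> A *m A = 0.
Proof.
move=> trA AA; have [c0|c0] := eqVneq c 0; first by rewrite AA c0 scale0r.
have := @mxtrace_idempotent n (c^-1 *: A).
rewrite -scalemxAl -scalemxAr AA scalerK // linearZ /= trA mulr0 => /(_ erefl) /eqP.
rewrite eq_sym pnatr_eq0 mxrank_eq0 scaler_eq0 invr_eq0 (negPf c0) => /eqP->.
by rewrite scaler0.
Qed.

End IdempotentTrace.

Section SeaweedContact.
Variables (K : numFieldType) (n : nat) (a b : seq nat).
Local Notation g := (seaweed K n a b).
Implicit Types (x y z : g) (A B : 'M[K]_n).

Definition in_pattern A := forall i j, ~~ seaweed_pos a b i j -> A i j = 0.

Lemma in_patternM A B : in_pattern A -> in_pattern B -> in_pattern (A *m B).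
Proof.
move=> A0 B0 i j nij; rewrite mxE big1 // => k _.
have [ik|/A0->] := boolP (seaweed_pos a b i k); last by rewrite mul0r.
by rewrite B0 ?mulr0 //; apply: contra nij; apply: seaweed_pos_trans.
Qed.

Lemma seaweed_pattern x : in_pattern (vsval x).
Proof. by have /memv_seaweed[] := subvsP x. Qed.

Lemma seaweed_trace x : \tr (vsval x) = 0.
Proof. by have /memv_seaweed[] := subvsP x. Qed.

Definition traceless_part A : 'M[K]_n := A - (\tr A / n%:R)%:M.

(** The seaweed is a traceless part of an associative algebra; products of its
    elements come back into it after subtraction of a scalar matrix, which no
    commutator sees. *)
Definition seaweed_of A : g := vsproj (seaweed_space K n a b) (traceless_part A).

Lemma seaweed_ofE A : (0 < n)%N -> in_pattern A ->
  vsval (seaweed_of A) = traceless_part A.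
Proof.
move=> n0 A0; rewrite vsprojK //; apply/memv_seaweed; split.
  by rewrite linearB /= mxtrace_scalar -[_ *+ n]mulr_natr divfK ?subrr // pnatr_eq0 -lt0n.
move=> i j nij; rewrite !mxE A0 // sub0r (_ : (i == j) = false) ?oppr0 //.
by apply: contraNF nij => /eqP->; rewrite /seaweed_pos leqnn /same_block eqxx.
Qed.

Lemma vsval0 : vsval (0 : g) = 0.
Proof. exact: linear0. Qed.

Lemma vsvalD x y : vsval (x + y) = vsval x + vsval y.
Proof. exact: linearD. Qed.

Lemma vsvalZ c x : vsval (c *: x) = c *: vsval x.
Proof. exact: linearZ. Qed.

Lemma val_lie x y : vsval (lie x y) = Defs.commutator (vsval x) (vsval y).
Proof. by []. Qed.

Lemma commutator_traceless_part A B : Defs.commutator A (traceless_part B) = Defs.commutator A B.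
Proof.
rewrite /Defs.commutator /traceless_part mulmxBr mulmxBl mul_mx_scalar mul_scalar_mx.
by rewrite opprB addrA subrK.
Qed.

Lemma traceless_part_commutator A B : Defs.commutator (traceless_part A) B = Defs.commutator A B.
Proof.
by apply: oppr_inj; rewrite /Defs.commutator !opprB; apply: commutator_traceless_part.
Qed.

(** [x^2, y] = [x, x y] + [x, y x]. *)
Lemma kernel_square phi x : (0 < n)%N ->
  x \in kirillov_ker phi -> seaweed_of (vsval x *m vsval x) \in kirillov_ker phi.
Proof.
move=> n0 /kirillov_kerP x_ker; apply/kirillov_kerP => y.
have [Px Py] := (seaweed_pattern x, seaweed_pattern y).
have -> : lie (seaweed_of (vsval x *m vsval x)) y =
    lie x (seaweed_of (vsval x *m vsval y)) + lie x (seaweed_of (vsval y *m vsval x)).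
    apply: subvs_inj; rewrite vsvalD !val_lie.
  rewrite !seaweed_ofE //; try exact: in_patternM.
  rewrite traceless_part_commutator !commutator_traceless_part /Defs.commutator.
  by rewrite !mulmxA addrA subrK.
by rewrite linearD /= !x_ker addr0.
Qed.

Definition trace_form A : 'Hom(g, K^o) := linfun (fun y : g => \tr (A *m vsval y) : K^o).

Lemma trace_formE A y : trace_form A y = \tr (A *m vsval y).
Proof.
have lin : linear (fun y : g => \tr (A *m vsval y) : K^o).
  by move=> c u v; rewrite vsvalD vsvalZ mulmxDr -scalemxAr mxtraceD mxtraceZ.
pose m := GRing.isLinear.Build _ _ _ _ _ lin.
pose f : {linear g -> K^o} := HB.pack (fun y : g => \tr (A *m vsval y) : K^o) m.
exact: (lfunE f).
Qed.

(** If tr (x^2) = 0, then x^2 is in the kernel line of x, hence proportional to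
    x, hence zero. Otherwise y |-> tr (x y) is the direction in which to
    deform phi. *)
Lemma contact_of_square phi x : \dim (kirillov_ker phi) = 1%N ->
  x \in kirillov_ker phi -> vsval x *m vsval x != 0 -> contact g.
Proof.
move=> ker1 x_ker xx.
have n0 : (0 < n)%N.
  by rewrite lt0n; apply: contra_neq xx => n0; apply/matrixP => i; exfalso; have := ltn_ord i; lia.
have x0 : x != 0 by apply: contra_neq xx => ->; rewrite vsval0 mul0mx.
have kerE : kirillov_ker phi = <[x]>%VS.
  by apply/eqP; rewrite eq_sym eqEdim ker1 dim_vline x0 andbT -memvE.
have trxx : \tr (vsval x *m vsval x) != 0.
  apply: contra_neq xx => trxx.
  have := kernel_square n0 x_ker; rewrite kerE => /vlineP[c xxE].
  apply: (@traceless_square_proportional _ _ _ c); first exact: seaweed_trace.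
  have := congr1 vsval xxE; rewrite seaweed_ofE // ?vsvalZ /traceless_part.
    by rewrite trxx mul0r raddf0 subr0.
  by apply: in_patternM; apply: seaweed_pattern.
apply: (contact_of_regular (delta := trace_form (vsval x)) kerE x0).
  move=> y; rewrite trace_formE val_lie /Defs.commutator mulmxBr linearB /=.
  by rewrite [X in _ - \tr X]mulmxA [X in _ - X]mxtrace_mulC subrr.
by rewrite trace_formE.
Qed.

(** The kernel condition is tested on matrix units, made traceless. *)
Lemma kernel_trace_form_stabilizes A x i j : (0 < n)%N ->
    x \in kirillov_ker (trace_form A) -> seaweed_pos a b i j ->
  (vsval x *m A) j i = (A *m vsval x) j i.
Proof.
move=> n0 /kirillov_kerP x_ker ij.
have Pij : in_pattern (delta_mx i j).
  move=> i' j' nij; rewrite mxE; case: eqP => //= ii; case: eqP => //= jj.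
  by rewrite ii jj ij in nij.
have tr_delta B : \tr (B *m delta_mx i j) = B j i.
  rewrite /mxtrace (bigD1 j) //= big1 ?addr0 => [|k kj].
    rewrite mxE (bigD1 i) //= big1 ?addr0 ?mxE ?eqxx ?mulr1 // => l li.
    by rewrite mxE (negPf li) mulr0.
  by rewrite mxE big1 // => l _; rewrite mxE (negPf kj) andbF mulr0.
have := x_ker (seaweed_of (delta_mx i j)).
rewrite trace_formE val_lie seaweed_ofE // commutator_traceless_part /Defs.commutator.
rewrite mulmxBr linearB /= mulmxA tr_delta mulmxA mxtrace_mulC mulmxA tr_delta.
by move/eqP; rewrite subr_eq0 eq_sym => /eqP.
Qed.

End SeaweedContact.

Lemma seaweed_form_reduced (K : numFieldType) n a b :
    is_composition n a -> is_composition n b ->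
  exists A : 'M[K]_n, forall x : seaweed K n a b,
    x \in kirillov_ker (trace_form a b A) -> vsval x *m vsval x = 0 -> x = 0.
Proof.
case: n => [|n].
  by move=> _ _; exists 0 => x _ _; apply: subvs_inj; apply/matrixP => -[].
case/andP=> /eqP sum_a _ /andP[/eqP sum_b _].
have := @seaweed_has_reduced_stabilizer K 0 a b; rewrite sum_a sum_b add0n.
case=> // F redF; exists (\matrix_(i, j) F i j) => x x_ker xx.
pose xn i j : K := vsval x (inord i) (inord j).
have relE i j : (i < n.+1)%N -> (j < n.+1)%N ->
    seaweed_rel 0 a b i j = seaweed_pos a b (inord i : 'I_n.+1) (inord j : 'I_n.+1).
  move=> i_n j_n; rewrite /seaweed_rel /seaweed_pos !in_blockE ?sum_a ?sum_b ?add0n //.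
  by rewrite !subn0 !inordK.
suff xn0 i j : (i < n.+1)%N -> (j < n.+1)%N -> xn i j = 0.
  apply: subvs_inj; apply/matrixP => i j; rewrite vsval0 mxE.
  by have := xn0 i j (ltn_ord i) (ltn_ord j); rewrite /xn !inord_val.
move=> i_n j_n; apply: redF => // {i j i_n j_n} i j /andP[_ i_n] /andP[_ j_n].
- by rewrite relE //; apply: seaweed_pattern.
- rewrite relE // => /(kernel_trace_form_stabilizes (ltn0Sn n) x_ker).
  rewrite !mxE !big_mkord => E.
  transitivity (\sum_l vsval x (inord j) l * (\matrix_(i, j) F i j) l (inord i : 'I_n.+1)).
    by apply: eq_bigr => l _; rewrite mxE inordK // /xn inord_val.
  by rewrite E; apply: eq_bigr => l _; rewrite mxE inordK // /xn inord_val.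
transitivity ((vsval x *m vsval x) (inord i) (inord j)); last by rewrite xx mxE.
by rewrite big_mkord mxE; apply: eq_bigr => l _; rewrite /xn inord_val.
Qed.

Theorem theorem5 (R : realType) (n : nat) (a b : seq nat)
    (ha : is_composition n a) (hb : is_composition n b) :
  contact (seaweed R[i] n a b) <-> lie_index (seaweed R[i] n a b) = 1%N.
Proof.
split=> [|/index1_kernels[[phi1 ker1] ker_gt0]]; first exact: contact_index.
apply: contrapT => not_contact.
have [A A_red] := seaweed_form_reduced R[i] ha hb.
pose Q (ij : 'I_n * 'I_n) (x y : seaweed R[i] n a b) :=
  (vsval x *m vsval y) ij.1 ij.2.
have [] := @kernel_limit _ _ _ Q (trace_form a b A) phi1 _ _ ker_gt0 ker1.
- by move=> ij c x y z; rewrite /Q vsvalD vsvalZ mulmxDl -scalemxAl !mxE.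
- by move=> ij c x y z; rewrite /Q vsvalD vsvalZ mulmxDr -scalemxAr !mxE.
- move=> phi x kerx x_ker ij; rewrite /Q; case: (eqVneq (vsval x *m vsval x) 0) => [->|xx].
    by rewrite mxE.
  by case: not_contact; apply: contact_of_square kerx x_ker xx.
move=> x x0 [x_ker Qx]; move/eqP: x0; apply; apply: A_red => //.
by apply/matrixP => i j; rewrite [RHS]mxE; apply: (Qx (i, j)).
Qed.
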